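(* There is no quartic number field $K$ such that the number of elliptic curves $E$ over $K$ with $\mathbb{Z}/3\mathbb{Z}\oplus\mathbb{Z}/9\mathbb{Z}$ isomorphic to a subgroup of $E(K)$ is positive and finite.
   Context: Elliptic curves are counted up to isomorphism over $\overline{K}$. *)

(* Defs.v *)
From HB Require Import structures.
From mathcomp Require Import all_boot all_order all_algebra all_field.
From mathcomp Require Import boolp classical_sets functions cardinality.

Set Implicit Arguments.
Unset Strict Implicit.
Unset Printing Implicit Defensive.
Import GRing.Theory.
Local Open Scope ring_scope.

(* Coefficients of y^2 + a1 x y + a3 y = x^3 + a2 x^2 + a4 x + a6. *)
Record weierstrass (F : Type) := Weierstrass {
  wa1 : F; wa2 : F; wa3 : F; wa4 : F; wa6 : F
}.

Definition map_weierstrass (F L : Type) (f : F -> L) (W : weierstrass F) :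
    weierstrass L :=
  Weierstrass (f (wa1 W)) (f (wa2 W)) (f (wa3 W)) (f (wa4 W)) (f (wa6 W)).

Section Curve.
Variables (F : fieldType) (W : weierstrass F).

Let a1 := wa1 W.
Let a2 := wa2 W.
Let a3 := wa3 W.
Let a4 := wa4 W.
Let a6 := wa6 W.

Definition discriminant : F :=
  let b2 := a1 ^+ 2 + 4 * a2 in
  let b4 := 2 * a4 + a1 * a3 in
  let b6 := a3 ^+ 2 + 4 * a6 in
  let b8 := a1 ^+ 2 * a6 + 4 * a2 * a6 - a1 * a3 * a4 + a2 * a3 ^+ 2
            - a4 ^+ 2 in
  - b2 ^+ 2 * b8 - 8 * b4 ^+ 3 - 27 * b6 ^+ 2 + 9 * b2 * b4 * b6.

Definition elliptic : bool := discriminant != 0.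

(* [None] is the point at infinity. *)
Definition on_curve (P : option (F * F)) : bool :=
  if P is Some (x, y) then
    y ^+ 2 + a1 * x * y + a3 * y == x ^+ 3 + a2 * x ^+ 2 + a4 * x + a6
  else true.

(* The chord-and-tangent law; it is the group law only for points that satisfy
   [on_curve].  The test [y1 + y2 + a1 x1 + a3 = 0] says that the second point
   is the negative of the first; when it fails and x1 = x2 the two points
   coincide and [l] is the slope of the tangent. *)
Definition add_point (P Q : option (F * F)) : option (F * F) :=
  match P, Q with
  | None, _ => Q
  | _, None => P
  | Some (x1, y1), Some (x2, y2) =>
    if (x1 == x2) && (y1 + y2 + a1 * x1 + a3 == 0) then None
    else
      let l := if x1 == x2
               then (3 * x1 ^+ 2 + 2 * a2 * x1 + a4 - a1 * y1)
                    / (2 * y1 + a1 * x1 + a3)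
               else (y2 - y1) / (x2 - x1) in
      let x3 := l ^+ 2 + a1 * l - a2 - x1 - x2 in
      Some (x3, - (l + a1) * x3 - (y1 - l * x1) - a3)
  end.

(* The group of F-rational points has a subgroup isomorphic to A. *)
Definition has_subgroup_isog (A : zmodType) : Prop :=
  exists f : A -> option (F * F),
    [/\ injective f, forall g, on_curve (f g)
      & forall g h, f (g + h) = add_point (f g) (f h)].

End Curve.

(* Isomorphism over F of Weierstrass curves: W' is obtained from W by an
   admissible change of variables x = u^2 x' + r, y = u^3 y' + s u^2 x' + t. *)
Definition isomorphic (F : fieldType) (W W' : weierstrass F) : Prop :=
  exists u r s t : F,
    [/\ u != 0,
        u * wa1 W' = wa1 W + 2 * s,
        u ^+ 2 * wa2 W' = wa2 W - s * wa1 W + 3 * r - s ^+ 2,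
        u ^+ 3 * wa3 W' = wa3 W + r * wa1 W + 2 * t
      & u ^+ 4 * wa4 W' = wa4 W - s * wa3 W + 2 * r * wa2 W
                          - (t + r * s) * wa1 W + 3 * r ^+ 2 - 2 * s * t
        /\ u ^+ 6 * wa6 W' = wa6 W + r * wa4 W + r ^+ 2 * wa2 W + r ^+ 3
                             - t * wa3 W - t ^+ 2 - r * t * wa1 W].

Local Open Scope classical_set_scope.

(* The class of W among the elliptic curves over K, for isomorphism over the
   extension Kbar of K. *)
Definition geom_class (K Kbar : fieldType) (iota : {rmorphism K -> Kbar})
    (W : weierstrass K) : set (weierstrass K) :=
  [set W' | elliptic W' /\
    isomorphic (map_weierstrass iota W) (map_weierstrass iota W')].

Definition classes_with_subgroup (K Kbar : fieldType)
    (iota : {rmorphism K -> Kbar}) (A : zmodType) :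
    set (set (weierstrass K)) :=
  geom_class iota @` [set W | elliptic W /\ has_subgroup_isog W A].

(* Main.v *)
(* The points of order dividing 3 put an elliptic curve with a Z/3 + Z/9
   subgroup into Hesse form X^3 + Y^3 + Z^3 = 3t XYZ, with translation by the
   3-torsion acting by monomial matrices in 1, w, w^2, where w is a primitive
   cube root of unity; it lies in K because the full 3-torsion does.  A point
   (x : y : z) with 3 (x : y : z) = T, the flex acting as diag(1, w^2, w), is
   one whose tangent passes through its translate by -T, that is
     x^3 + w y^3 + w^2 z^3 = 0,
   and conversely such a point determines t and gives back the subgroup unless
   it is a cusp: xyz = 0 or x^3 = y^3 = z^3.  So the curves are parametrized by
   the noncuspidal K-points of this twisted Fermat cubic.

   Let v be a valuation of K above 2.  As K is quadratic over Q(w), in which 2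
   is inert, the ramification index of v is at most 2 and the residue field has
   at most 16 elements; over such a field all points of the cubic satisfy
   x^3 = y^3 = z^3.  So p = x^3 + w^2 y^3 + w z^3, which vanishes exactly when
   x^3 = y^3 = z^3, has v(p) > 0 at every normalized K-point, and the tangent
   construction multiplies p by 2 times a unit, because v(p^3) > v(2).  Since
   the j-invariant is a unit over p^9, a single noncuspidal point yields
   infinitely many j-invariants. *)
Require Import Defs.
From HB Require Import structures.
From mathcomp Require Import all_boot all_order all_algebra all_field.
From mathcomp Require Import boolp classical_sets functions cardinality.
From mathcomp Require Import ring zify.
Set Implicit Arguments.
Unset Strict Implicit.
Unset Printing Implicit Defensive.
Import GRing.Theory.
Local Open Scope ring_scope.

(** * Valuation rings of a field *)

Section ValuationRing.
Local Open Scope classical_set_scope.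

Section Adjoin.
Variables (K : fieldType) (A : subringClosed K).

Definition adjoin (x : K) : set K :=
  [set z | exists2 p, p \is a polyOver A & z = p.[x]].

Lemma adjoin_sub x z : z \in A -> adjoin x z.
Proof. by move=> Az; exists z%:P; rewrite ?polyOverC ?hornerC. Qed.

Lemma adjoin_gen x : adjoin x x.
Proof. by exists 'X; rewrite ?polyOverX ?hornerX. Qed.

Lemma adjoin_subring x : subring_closed (fun z => `[< adjoin x z >]).
Proof.
split=> [|y z /asboolP[p Ap ->] /asboolP[q Aq ->]|
  y z /asboolP[p Ap ->] /asboolP[q Aq ->]]; apply/asboolP.
- by apply: adjoin_sub; rewrite rpred1.
- by exists (p - q); rewrite ?rpredB // !hornerE.
- by exists (p * q); rewrite ?rpredM // !hornerE.
Qed.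

(* If 1 = c p(x) = c q(1/x) with deg p >= deg q, the second relation expresses
   x^(deg p) through lower powers of x, since 1 - c q(0) is invertible; this
   lowers the degree of p. *)
Lemma no_common_denominator (c : K) : c \in A -> c^-1 \notin A ->
    (forall b, b \in A -> (1 - c * b)^-1 \in A) ->
  forall N (x : K) (p q : {poly K}), x != 0 ->
    p \is a polyOver A -> q \is a polyOver A ->
    (size p + size q <= N)%N -> c * p.[x] = 1 -> c * q.[x^-1] = 1 -> False.
Proof.
move=> Ac NAc jac; elim=> [|N IHN] x p q x0 Ap Aq spq px qx.
  have /eqP := px; rewrite (_ : p = 0) ?horner0 ?mulr0 1?eq_sym ?oner_eq0 //.
  by apply/eqP; rewrite -size_poly_eq0; case: (size p) spq.
have c0 : c != 0.
  by apply: contra_eq_neq px => ->; rewrite mul0r eq_sym oner_eq0.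
(* The situation is symmetric in [x] and [x^-1], so [y] stands for either of them and the polynomial
   in [y] is taken to be the longer one. *)
have wl (y : K) (r s : {poly K}) : y != 0 -> r \is a polyOver A ->
    s \is a polyOver A -> (size r + size s <= N.+1)%N -> (size s <= size r)%N ->
    c * r.[y] = 1 -> c * s.[y^-1] = 1 -> False.
  move=> {x p q x0 Ap Aq spq px qx} y0 Ar As srs lesr ry sy.
  have sr1 : (1 < size r)%N.
    rewrite ltnNge; apply/negP => /size1_polyC r0.
    move/negP: NAc; apply; rewrite (_ : c^-1 = r`_0) ?(polyOverP Ar) //.
    by move: ry; rewrite r0 hornerC coefC eqxx => e; rewrite -[LHS]mulr1 -e mulKf.
  set n := (size r).-1.
  have nE : size r = n.+1 by rewrite prednK // ltnW.
  set d := (1 - c * s`_0)^-1.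
  have Ad : d \in A by apply/jac/(polyOverP As).
  have d0 : 1 - c * s`_0 != 0.
    apply: contra NAc; rewrite subr_eq0 => /eqP e.
    by rewrite -[c^-1]mulr1 e mulKf // (polyOverP As).
  pose r' := \poly_(i < n) (r`_i + c * d * r`_n * s`_(n - i)).
  have Ar' : r' \is a polyOver A.
    apply/polyOverP => i; rewrite coef_poly; case: ifP => _; rewrite ?rpred0 //.
    by rewrite rpredD ?rpredM ?(polyOverP Ar) ?(polyOverP As).
  apply: (IHN y r' s) => //.
    rewrite -ltnS; apply: leq_trans srs; rewrite ltn_add2r nE ltnS.
    exact: size_poly.
  have sE : s.[y^-1] = \sum_(i < n.+1) s`_i * y^-1 ^+ i.
    rewrite (horner_coef_wide _ (n := n.+1)) //; by rewrite -nE.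
  have yn : y ^+ n = c * d * \sum_(i < n) s`_(n - i) * y ^+ i.
    have : y ^+ n * (1 - c * s`_0) = c * \sum_(i < n) s`_(n - i) * y ^+ i.
      rewrite mulrBr mulr1 -{1}[y ^+ n]mulr1 -sy sE big_ord_recl /= expr0 mulr1.
      rewrite mulrDr [y ^+ n * (_ + _)]mulrDr addrAC subrr add0r mulrCA.
      congr (_ * _); rewrite mulr_sumr.
      rewrite (reindex_inj rev_ord_inj) /=; apply: eq_bigr => i _.
      rewrite /bump /= add1n subnSK // mulrCA; congr (_ * _).
      by rewrite exprVn -expfB_cond ?(negPf y0) ?leq_subr // subKn // ltnW.
    by move=> /(canRL (mulfK d0)) ->; rewrite /d; ring.
  rewrite -ry; congr (_ * _); rewrite horner_poly.
  under eq_bigr => i _ do rewrite mulrDl.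
  rewrite big_split /= horner_coef nE big_ord_recr /=; congr (_ + _).
  rewrite yn !mulr_sumr; apply: eq_bigr => i _; ring.
case: (leqP (size q) (size p)) => [le|/ltnW le]; first exact: (wl x p q).
apply: (wl x^-1 q p); rewrite ?invr_eq0 ?invrK //.
by rewrite addnC.
Qed.

End Adjoin.

(** Zorn's lemma gives a subring maximal among those avoiding 1/n. Adjoining an outside element y
    must produce 1/n, that is, a relation n p(y) = 1; such relations for both x and 1/x contradict
    [no_common_denominator]. *)
Lemma valuation_ring_exists (K : fieldType) (n : nat) :
    (forall m : int, m%:~R != n%:R^-1 :> K) ->
  exists V : subringClosed K,
    n%:R^-1 \notin V /\ forall x, (x \in V) || (x^-1 \in V).
Proof.
(* Nonemptiness is a premise because Zorn's lemma also takes the union of the empty chain. The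
   maximal set is nonempty, as the image of the integers satisfies [P]. *)
move=> nN; pose P (A : set K) := A !=set0 ->
  subring_closed (fun z => `[< A z >]) /\ ~ A n%:R^-1.
have [F FP tF|A [PA maxA]] := @Zorn_bigcup K P.
  case=> x0 [B0 FB0 B0x0]; split; last first.
    by case=> B FB Bn; have [_] := FP B FB (ex_intro _ _ Bn).
  have up x y : (\bigcup_(X in F) X) x -> (\bigcup_(X in F) X) y ->
      exists B, [/\ F B, B x & B y].
    case=> B FB Bx [C FC Cy]; case: (tF _ _ FB FC) => s.
      by exists C; split=> //; apply: s.
    by exists B; split=> //; apply: s.
  split=> [|x y /asboolP Ux /asboolP Uy|x y /asboolP Ux /asboolP Uy].
  - apply/asboolP; exists B0 => //.
    by have [[/asboolP]] := FP B0 FB0 (ex_intro _ _ B0x0).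
  - have [B [FB Bx By]] := up _ _ Ux Uy; apply/asboolP; exists B => //.
    have [[_ s _] _] := FP B FB (ex_intro _ _ Bx).
    by apply/asboolP/s; apply/asboolP.
  - have [B [FB Bx By]] := up _ _ Ux Uy; apply/asboolP; exists B => //.
    have [[_ _ s] _] := FP B FB (ex_intro _ _ Bx).
    by apply/asboolP/s; apply/asboolP.
have A0 : A !=set0.
  apply: contrapT => A0; apply: (maxA [set m%:~R | m in [set: int]]).
    split=> [x Ax|/(_ 1)]; first by case: A0; exists x.
    by move=> /(_ (ex_intro2 _ _ 1 I erefl)) A1; apply: A0; exists 1.
  move=> _; split; last by case=> m _ /eqP; apply/negP.
  split=> [|_ _ /asboolP[a _ <-] /asboolP[b _ <-]|
    _ _ /asboolP[a _ <-] /asboolP[b _ <-]]; apply/asboolP.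
  - by exists 1.
  - by exists (a - b); rewrite ?rmorphB.
  - by exists (a * b); rewrite ?rmorphM.
have [clA nA] := PA A0.
have [V VE] : exists V : subringClosed K, forall z, (z \in V) = `[< A z >].
  pose VP : {pred K} := fun z => `[< A z >].
  by exists (HB.pack_for (subringClosed K) VP
    (GRing.isSubringClosed.Build K VP clA)).
have nV : n%:R^-1 \notin V by rewrite VE; apply/asboolP.
exists V; split=> // x.
have ext y : y \notin V -> exists2 p, p \is a polyOver V & n%:R * p.[y] = 1.
  move=> yV; have /contrapT : ~ ~ adjoin V y n%:R^-1.
    move=> nAd; apply: (maxA (adjoin V y)).
      split=> [z Az|s]; first by apply: adjoin_sub; rewrite VE; apply/asboolP.
      by move: yV; rewrite VE => /asboolP[]; apply: s; apply: adjoin_gen.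
    by move=> _; split=> //; apply: adjoin_subring.
  case=> p Vp e; exists p => //; rewrite -e mulfV //.
  by apply: contra (nN 0) => /eqP ->; rewrite invr0.
(* If d = 1 - n b had no inverse in [V], clearing denominators in n p(1/d) = 1 would make a power of
   d a multiple of n. That power is also 1 modulo n, so 1/n would lie in [V]. *)
have jac b : b \in V -> (1 - n%:R * b)^-1 \in V.
  move=> Vb; apply: contraT => /ext[p Vp e].
  have d0 : 1 - n%:R * b != 0.
    apply: contraNneq nV => /eqP; rewrite subr_eq0 => /eqP e1.
    suff -> : n%:R^-1 = b by [].
    have n0 : n%:R != 0 :> K.
      by apply: contra_eq_neq e1 => ->; rewrite mul0r oner_eq0.
    by apply: (mulfI n0); rewrite mulfV.
  set d := 1 - n%:R * b in e d0.
  have Vd : d \in V by rewrite rpredB ?rpred1 ?rpredM ?rpred_nat.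
  have : exists2 z, z \in V & d ^+ size p = n%:R * z.
    exists (\sum_(i < size p) p`_i * d ^+ (size p - i)).
      by apply: rpred_sum => i _; rewrite rpredM ?rpredX ?(polyOverP Vp).
    rewrite -[LHS]mulr1 -[X in _ * X = _]e horner_coef mulrCA mulr_sumr; congr (_ * _).
    apply: eq_bigr => i _; by rewrite mulrCA exprVn expfB.
  case=> z Vz dz.
  have : exists2 y, y \in V & d ^+ size p = 1 - n%:R * y.
    elim: (size p) => [|k [y Vy IH]]; first by exists 0; rewrite ?rpred0 ?mulr0 ?subr0.
    exists (y + b - n%:R * y * b); last by rewrite exprS IH /d; ring.
    by rewrite rpredB ?rpredD ?rpredM ?rpred_nat.
  case=> y Vy dy; have e1 : n%:R * (z + y) = 1 by rewrite mulrDr -dz dy subrK.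
  case/negP: nV; suff -> : n%:R^-1 = z + y by rewrite rpredD.
  have n0 : n%:R != 0 :> K.
    by apply: contra_eq_neq e1 => ->; rewrite mul0r eq_sym oner_eq0.
  by apply: (mulfI n0); rewrite mulfV.
apply: contraT; rewrite negb_or => /andP[/[dup] xV /ext[p Vp px] /ext[q Vq qx]].
case: (@no_common_denominator K V n%:R _ nV jac _ x p q _ Vp Vq (leqnn _) px qx).
  exact: rpred_nat.
by apply: contraNneq xV => ->; rewrite rpred0.
Qed.

End ValuationRing.

Ltac in_ring := repeat first [assumption | apply: rpred1 | apply: rpred_nat
  | apply: rpredB | apply: rpredD | rewrite rpredN | apply: rpredM
  | apply: rpredX].

(** * Maximal ideal, units and congruences of a valuation ring *)

Section Valuation.
Variables (K : fieldType) (V : subringClosed K).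
Hypothesis totV : forall x, (x \in V) || (x^-1 \in V).

(** The maximal ideal: by [totV], an element whose inverse lies outside [V] lies in [V] itself and
    is not a unit there. *)
Definition vmax : {pred K} := [pred x | (x == 0) || (x^-1 \notin V)].
Definition vunit : {pred K} := [pred x | (x \in V) && (x \notin vmax)].

Lemma vmaxW x : x \in vmax -> x \in V.
Proof.
case/orP=> [/eqP ->|]; first exact: rpred0.
by case/orP: (totV x) => // ->.
Qed.

Lemma vunitP x : reflect [/\ x != 0, x \in V & x^-1 \in V] (x \in vunit).
Proof.
rewrite !inE negb_or negbK.
by apply: (iffP and3P) => [[? ? ?]|[? ? ?]]; split.
Qed.

Lemma vunitW x : x \in vunit -> x \in V.
Proof. by case/andP. Qed.

Lemma vunit_neq0 x : x \in vunit -> x != 0.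
Proof. by case/vunitP. Qed.

Lemma mem_vunit x : x \in V -> x \notin vmax -> x \in vunit.
Proof. by rewrite [x \in vunit]inE => -> ->. Qed.

Lemma vmax_vunit x : x \in vunit -> x \notin vmax.
Proof. by case/andP. Qed.

Lemma vmax0 : 0 \in vmax.
Proof. by rewrite inE eqxx. Qed.

Lemma vmax1 : 1 \notin vmax.
Proof. by rewrite inE negb_or oner_eq0 invr1 negbK rpred1. Qed.

Lemma vmaxMl x y : x \in V -> y \in vmax -> x * y \in vmax.
Proof.
move=> Vx /orP[/eqP ->|My]; first by rewrite mulr0 vmax0.
rewrite inE; have [->|x0] := eqVneq x 0; first by rewrite mul0r eqxx.
apply/orP; right; apply: contra My => Vxy.
by rewrite -[y^-1](mulKf x0) mulrCA -invfM rpredM.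
Qed.

Lemma vmaxMr x y : x \in V -> y \in vmax -> y * x \in vmax.
Proof. by rewrite mulrC; apply: vmaxMl. Qed.

Lemma vmaxD x y : x \in vmax -> y \in vmax -> x + y \in vmax.
Proof.
have [->|x0] := eqVneq x 0; first by rewrite add0r.
have [->|y0] := eqVneq y 0; first by rewrite addr0.
move=> Mx My; case/orP: (totV (x / y)) => Vxy.
  rewrite (_ : x + y = (x / y + 1) * y); first by rewrite vmaxMl ?rpredD ?rpred1.
  by field.
rewrite (_ : x + y = (1 + (x / y)^-1) * x).
  by rewrite vmaxMl ?rpredD ?rpred1.
by field; rewrite x0 y0.
Qed.

Lemma vmaxN x : x \in vmax -> - x \in vmax.
Proof. by move=> Mx; rewrite -mulN1r vmaxMl ?rpredN ?rpred1. Qed.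

Lemma vmaxB x y : x \in vmax -> y \in vmax -> x - y \in vmax.
Proof. by move=> Mx My; rewrite vmaxD ?vmaxN. Qed.

Lemma vunit1 : 1 \in vunit.
Proof. by rewrite mem_vunit ?rpred1 ?vmax1. Qed.

Lemma vunitM x y : x \in vunit -> y \in vunit -> x * y \in vunit.
Proof.
move=> /vunitP[x0 Vx Wx] /vunitP[y0 Vy Wy].
by apply/vunitP; rewrite mulf_neq0 // invfM !rpredM.
Qed.

Lemma vunitV x : x \in vunit -> x^-1 \in vunit.
Proof. by move=> /vunitP[x0 Vx Wx]; apply/vunitP; rewrite invr_eq0 invrK. Qed.

Lemma vunitX x n : x \in vunit -> x ^+ n \in vunit.
Proof. by move=> Ux; elim: n => [|n IH]; rewrite ?vunit1 // exprS vunitM. Qed.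

Lemma vmaxM x y : x \in V -> y \in V -> x * y \in vmax ->
  (x \in vmax) || (y \in vmax).
Proof.
move=> Vx Vy; apply: contraTT; rewrite negb_or => /andP[Mx My].
by apply/vmax_vunit/vunitM; apply: mem_vunit.
Qed.

Lemma vmaxX x n : x \in V -> x ^+ n \in vmax -> x \in vmax.
Proof. by move=> Vx; apply: contraTT => Mx; apply/vmax_vunit/vunitX/mem_vunit. Qed.

Lemma vmax_exp x n : (0 < n)%N -> x \in vmax -> x ^+ n \in vmax.
Proof.
by case: n => // n _ Mx; rewrite exprS vmaxMr // rpredX // vmaxW.
Qed.

Lemma vunitDm x y : x \in vunit -> y \in vmax -> x + y \in vunit.
Proof.
move=> Ux My; apply: mem_vunit; first by rewrite rpredD ?(vunitW Ux) ?(vmaxW My).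
by apply: contra (vmax_vunit Ux) => /vmaxB/(_ My); rewrite addrK.
Qed.

(** Equality in the residue field, without forming the quotient. *)
Definition veq x y := (x - y) \in vmax.

Lemma veqxx x : veq x x.
Proof. by rewrite /veq subrr vmax0. Qed.

Lemma veqC x y : veq x y -> veq y x.
Proof. by rewrite /veq => /vmaxN; rewrite opprB. Qed.

Lemma veq_trans x y z : veq x y -> veq y z -> veq x z.
Proof. by rewrite /veq => h1 h2; rewrite -(subrKA y) vmaxD. Qed.

Lemma veqD x y z t : veq x y -> veq z t -> veq (x + z) (y + t).
Proof. by rewrite /veq opprD addrACA; apply: vmaxD. Qed.

Lemma veqM x y z t : y \in V -> z \in V -> veq x y -> veq z t ->
  veq (x * z) (y * t).
Proof.
rewrite /veq => Vx Vt xy zt.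
rewrite (_ : x * z - y * t = (x - y) * z + y * (z - t)); last by ring.
by rewrite vmaxD ?(vmaxMr _ xy) ?(vmaxMl _ zt).
Qed.

Lemma veqX x y n : x \in V -> y \in V -> veq x y -> veq (x ^+ n) (y ^+ n).
Proof.
move=> Vx Vy xy; elim: n => [|n IH]; first by rewrite !expr0 veqxx.
by rewrite !exprS veqM ?rpredX.
Qed.

Lemma veq_vunit x y : veq x y -> y \in vunit -> x \in vunit.
Proof. by move=> xy Uy; rewrite -(subrK y x) addrC vunitDm. Qed.

(** * Valuations above 2: ramification and residue field *)

Section AboveTwo.
Hypothesis half : 2^-1 \notin V.

Lemma vmax_two : 2 \in vmax.
Proof. by rewrite inE half orbT. Qed.

Lemma vunit_three : 3 \in vunit.
Proof. by rewrite (natrD _ 1 2) vunitDm ?vunit1 ?vmax_two. Qed.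

(** The middle binomial coefficients 4, 6, 4 are even. The fourth power is used because it fixes the
    field of four elements, the residue field of Q(w) at 2. *)
Lemma veq_frobenius x y : x \in V -> y \in V ->
  veq ((x + y) ^+ 4) (x ^+ 4 + y ^+ 4).
Proof.
move=> Vx Vy; rewrite /veq.
rewrite (_ : _ - _ = 2 * (2 * x ^+ 3 * y + 3 * x ^+ 2 * y ^+ 2
  + 2 * x * y ^+ 3)); last by ring.
by apply: vmaxMr vmax_two; in_ring.
Qed.

(* The elements of the local ring of Z[w] at 2, where w is a primitive cube root
   of unity, satisfy this: 2 is inert in Z[w]. *)
Definition inert (a : K) :=
  [/\ a \in V, veq (a ^+ 4) a & a \in vmax -> a / 2 \in V].

(* This holds when K is at most quadratic over Q(w). *)
Hypothesis quad : forall z, exists a b c, [/\ inert a, inert b, inert c,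
  a + b * z + c * z ^+ 2 = 0 & [|| a \notin vmax, b \notin vmax | c \notin vmax]].

(* The ramification index of 2 is at most 2. *)
Lemma cube_div_two z : z \in vmax -> z ^+ 3 / 2 \in vmax.
Proof.
move=> Mz; have Vz := vmaxW Mz; apply: contraT.
rewrite inE negb_or negbK mulf_eq0 negb_or => /andP[/andP[z3 i2] V23].
have z0 : z != 0 by apply: contraNneq z3 => ->; rewrite expr0n.
have n2 : (2 : K) != 0 by rewrite -invr_eq0.
set y := (z ^+ 3 / 2)^-1 in V23.
(* With 2 = z^3 y and y in [V], the relation a + b z + c z^2 = 0 puts a in the maximal ideal. Then
   2, hence z^3, divides a; dividing the relation by z treats b and then c in the same way, so no
   coefficient is a unit. *)
have yE : 2 = z ^+ 3 * y by rewrite /y; field; rewrite n2 z0.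
have two_dvd x : x = x / 2 * (z ^+ 3 * y) by rewrite -yE divfK.
have [a [b [c [[Va _ ha] [Vb _ hb] [Vc _ hc] e]]]] := quad z.
have Ma : a \in vmax.
  rewrite (_ : a = - (z * (b + c * z))).
    by rewrite vmaxN ?vmaxMr // rpredD ?rpredM.
  by apply/eqP; rewrite -addr_eq0 -[X in _ == X]e; apply/eqP; ring.
have Va2 := ha Ma.
have e1 : b + c * z + a / 2 * y * z ^+ 2 = 0.
  apply: (mulfI z0); rewrite mulr0 -[RHS]e [X in _ = X + _ + _]two_dvd; ring.
have Mb : b \in vmax.
  rewrite (_ : b = - (z * (c + a / 2 * y * z))).
    by rewrite vmaxN // vmaxMr //; in_ring.
  by apply/eqP; rewrite -addr_eq0 -[X in _ == X]e1; apply/eqP; ring.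
have Vb2 := hb Mb.
have e2 : c + z * (a / 2 * y + b / 2 * y * z) = 0.
  apply: (mulfI z0); rewrite mulr0 -[RHS]e1 [X in _ = X + _ + _]two_dvd; ring.
have Mc : c \in vmax.
  rewrite (_ : c = - (z * (a / 2 * y + b / 2 * y * z))).
    by rewrite vmaxN // vmaxMr //; in_ring.
  by apply/eqP; rewrite -addr_eq0 e2.
by rewrite Ma Mb Mc.
Qed.

(* The residue field has at most 16 elements. *)
Lemma veq_exp16 z : z \in V -> veq (z ^+ 16) z.
Proof.
move=> Vz; have e4 x : x \in V -> veq (x ^+ 4) x -> veq (x ^+ 16) x.
  move=> Vx x4; apply: (veq_trans _ x4); rewrite (exprM x 4 4).
  by apply: veqX; rewrite ?rpredX.
have [a [b [c [[Va a4 _] [Vb b4 _] [Vc c4 _] e]]]] := quad z.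
(* If [c] vanishes in the residue field, the relation becomes linear and z is congruent to -a/b,
   which the fourth power fixes. *)
have [Mc|Mc _] := boolP (c \in vmax).
  have Mabz : a + b * z \in vmax.
    rewrite (_ : a + b * z = - (z ^+ 2 * c)).
      by rewrite vmaxN ?vmaxMl ?rpredX.
    by apply/eqP; rewrite -addr_eq0 -[X in _ == X]e; apply/eqP; ring.
  rewrite orbF; have [Mb|Mb _] := boolP (b \in vmax).
    rewrite orbF => /negP[].
    by rewrite -[a](addrK (b * z)) vmaxB ?vmaxMr.
  have /vunitP[b0 _ Wb] := mem_vunit Vb Mb.
  apply: e4 => //; have zr : veq z (- (a / b)).
    rewrite /veq opprK (_ : z + a / b = b^-1 * (a + b * z)) ?vmaxMl //.
    by field.
  apply: veq_trans (veqC zr).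
  apply: veq_trans (veqX 4 _ _ zr) _ => //; first by rewrite rpredN rpredM.
  have Wb4 : (b ^+ 4)^-1 \in V by rewrite -exprVn rpredX.
  rewrite /veq (_ : _ - _ =
    (b ^+ 4)^-1 * ((a ^+ 4 - a) + (- a / b) * (b ^+ 4 - b) + 2 * (a * b ^+ 3))).
    apply: vmaxMl => //; apply: vmaxD; last by apply: vmaxMr vmax_two; in_ring.
    by apply: vmaxD (a4) _; apply: vmaxMl b4; in_ring.
  by field.
have /vunitP[c0 _ Wc] := mem_vunit Vc Mc.
pose r := a / c; pose s := b / c.
have Vr : r \in V by rewrite rpredM.
have Vs : s \in V by rewrite rpredM.
have quo x : x \in V -> veq (x ^+ 4) x -> veq ((x / c) ^+ 4) (x / c).
  move=> Vx x4; rewrite /veq (_ : _ - _ =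
    c^-1 ^+ 4 * ((x ^+ 4 - x) - (x / c) * (c ^+ 4 - c))).
    by rewrite vmaxMl ?rpredX // vmaxB // vmaxMl // rpredM.
  by field.
have r4 : veq (r ^+ 4) r by apply: quo.
have s4 : veq (s ^+ 4) s by apply: quo.
have zE : z ^+ 2 + s * z + r = 0.
  by apply: (mulfI c0); rewrite mulr0 -[RHS]e /s /r; field.
have Vy : z ^+ 4 \in V by rewrite rpredX.
set y := z ^+ 4 in Vy *.
(* The fourth power fixes [r] and [s] in the residue field, so z^4 is again a root of X^2 + s X + r:
   either z, or the other root, which is z + s in characteristic 2. A second fourth power returns to
   z. *)
have : (y - z) * (y + z + s) \in vmax.
  have h : veq ((z ^+ 2 + s * z + r) ^+ 4) (y ^+ 2 + s * y + r).
    apply: veq_trans (veq_frobenius _ _) _; rewrite ?rpredD ?rpredM ?rpredX //.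
    apply: (veqD _ r4); apply: veq_trans (veq_frobenius _ _) _;
      rewrite ?rpredM ?rpredX //.
    apply: veqD; first by rewrite /y -!exprM veqxx.
    by rewrite exprMn veqM ?veqxx.
  move: h; rewrite zE expr0n /= => /veqC; rewrite /veq subr0.
  suff -> : (y - z) * (y + z + s) = y ^+ 2 + s * y + r by [].
  by rewrite -[RHS]subr0 -[X in _ = _ - X]zE; ring.
case/vmaxM/orP; rewrite ?rpredB ?rpredD // => yz; first by apply: e4.
have {}yz : veq y (z + s).
  rewrite /veq (_ : _ - _ = y + z + s - 2 * (z + s)); last by ring.
  by rewrite vmaxB // vmaxMr ?vmax_two ?rpredD.
rewrite (exprM z 4 4) -/y.
apply: veq_trans (veqX 4 _ _ yz) _; rewrite ?rpredD //.
apply: veq_trans (veq_frobenius _ _) _; rewrite ?rpredD // -/y.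
apply: veq_trans (veqD yz s4) _; rewrite /veq.
by rewrite (_ : _ - _ = 2 * s) ?vmaxMr ?vmax_two //; ring.
Qed.

Lemma veq_exp15 z : z \in vunit -> veq (z ^+ 15) 1.
Proof.
move=> /vunitP[z0 Vz Wz].
rewrite /veq (_ : _ - _ = z^-1 * (z ^+ 16 - z)); last by field.
exact: vmaxMl (veq_exp16 Vz).
Qed.

End AboveTwo.
End Valuation.

(** * Noncuspidal points of the twisted Fermat cubic *)

Section TwistedFermat.
Variables (K : fieldType) (w : K).

Definition fermat (x y z : K) : K := x ^+ 3 + w * y ^+ 3 + w ^+ 2 * z ^+ 3.
Definition cusp (x y z : K) : K := x ^+ 3 + w ^+ 2 * y ^+ 3 + w * z ^+ 3.
Definition hesse_parameter (x y z : K) : K :=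
  (x ^+ 3 + y ^+ 3 + z ^+ 3) / (3 * x * y * z).

(* Delta and c4 of y^2 + 3t xy + (t^3 - 1) y = x^3. *)
Definition hesse_disc (t : K) : K := 27 * (t ^+ 3 - 1) ^+ 3.
Definition hesse_c4 (t : K) : K := 9 * t * (t ^+ 3 + 8).

(** The point where the tangent at [P] to the diagonal cubic [fermat] meets it again. *)
Definition tangent (P : K * K * K) : K * K * K :=
  let: (x, y, z) := P in
  (x * (w * y ^+ 3 - w ^+ 2 * z ^+ 3), y * (w ^+ 2 * z ^+ 3 - x ^+ 3),
   z * (x ^+ 3 - w * y ^+ 3)).

Hypothesis w2 : w ^+ 2 = - w - 1.

Lemma cube_root1 : w ^+ 3 = 1.
Proof. by rewrite exprS w2; ring: w2. Qed.

Variable V : subringClosed K.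
Hypothesis totV : forall x, (x \in V) || (x^-1 \in V).
Hypothesis half : 2^-1 \notin V.
Hypothesis quad : forall z, exists a b c, [/\ inert V a, inert V b, inert V c,
  a + b * z + c * z ^+ 2 = 0
  & [|| a \notin vmax V, b \notin vmax V | c \notin vmax V]].

Local Notation m := (vmax V).
Local Notation U := (vunit V).
Local Notation veq := (veq V).

Lemma vunit_cube_root : w \in U.
Proof.
have w0 : w != 0.
  by apply: contra_eq_neq cube_root1 => ->; rewrite expr0n eq_sym oner_eq0.
have wV : w^-1 = w ^+ 2.
  by apply: (mulfI w0); rewrite mulfV // -cube_root1; ring.
case/orP: (totV w) => Vw; apply/vunitP; split=> //; rewrite ?wV ?rpredX //.
by rewrite -(invrK w) wV -exprVn rpredX.
Qed.
Let Uw := vunit_cube_root.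
Let Vw := vunitW Uw.

(** Multiplication by [w] permutes the coefficients 1, w, w^2 cyclically. *)
Lemma fermat_shift x y z : fermat x y z = 0 -> fermat z x y = 0.
Proof.
move=> e; rewrite -[RHS](mulr0 w) -e /fermat.
by ring: cube_root1.
Qed.

(** If x vanished in the residue field, then w y^3 = - w^2 z^3 there with y and z nonzero. Fifth
    powers, with y^15 = z^15 = 1, would give w^2 + w = 0, whereas w^2 + w = -1. *)
Lemma vunit_fermat1 x y z : x \in V -> y \in V -> z \in V ->
  [|| x \in U, y \in U | z \in U] -> fermat x y z = 0 -> x \in U.
Proof.
move=> Vx Vy Vz someU e; apply: mem_vunit => //; apply/negP => Mx.
have yz : veq (w * y ^+ 3) (- (w ^+ 2 * z ^+ 3)).
  rewrite /veq opprK (_ : _ + _ = - x ^+ 3); last first.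
    by apply/eqP; rewrite -addr_eq0 -[X in _ == X]e /fermat; apply/eqP; ring.
  by rewrite vmaxN // vmax_exp.
have Uz : z \in U.
  apply: mem_vunit => //; apply/negP => Mz.
  suff My : y \in m.
    by case/or3P: someU => /vmax_vunit; rewrite ?Mx ?My ?Mz.
  apply: (@vmaxX _ V _ 3) => //.
  have : w * y ^+ 3 \in m.
    rewrite -(addrK (w ^+ 2 * z ^+ 3) (w * _)) vmaxB //.
      by move: yz; rewrite /veq opprK.
    by rewrite vmaxMl ?rpredX // vmax_exp.
  by case/vmaxM/orP; rewrite ?rpredX // (negPf (vmax_vunit Uw)).
have Uy : y \in U.
  have : w * y ^+ 3 \in U.
    apply: veq_vunit yz _ => //.
    by rewrite -mulN1r vunitM ?vunitM ?vunitX //; apply/vunitP;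
       rewrite oppr_eq0 oner_eq0 invrN invr1 rpredN rpred1.
  move=> Uwy; apply: mem_vunit => //; apply/negP => My.
  by move: (vmax_vunit Uwy); rewrite vmaxMl // vmax_exp.
have e15 : veq (w ^+ 5 * y ^+ 15) (- (w ^+ 10 * z ^+ 15)).
  rewrite (_ : w ^+ 5 * y ^+ 15 = (w * y ^+ 3) ^+ 5); last by ring.
  rewrite (_ : - _ = (- (w ^+ 2 * z ^+ 3)) ^+ 5); last by ring.
  by apply: veqX => //; in_ring.
have y15 := veq_exp15 totV half quad Uy.
have z15 := veq_exp15 totV half quad Uz.
suff : -1 \in m by move/vmaxN; rewrite opprK (negPf (vmax1 V)).
rewrite (_ : -1 = (w ^+ 5 * y ^+ 15 - - (w ^+ 10 * z ^+ 15))
  - w ^+ 5 * (y ^+ 15 - 1) - w ^+ 10 * (z ^+ 15 - 1)); last by ring: w2.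
by apply: vmaxB; [|apply: vmaxB|]; rewrite ?vmaxMl //; in_ring.
Qed.

Lemma vunit_fermat x y z : x \in V -> y \in V -> z \in V ->
    [|| x \in U, y \in U | z \in U] -> fermat x y z = 0 ->
  [/\ x \in U, y \in U & z \in U].
Proof.
move=> Vx Vy Vz s e; split; first exact: vunit_fermat1 s e.
  apply: (@vunit_fermat1 y z x) => //; first by case/or3P: s => ->; rewrite ?orbT.
  exact/fermat_shift/fermat_shift.
apply: (@vunit_fermat1 z x y) => //; first by case/or3P: s => ->; rewrite ?orbT.
exact/fermat_shift.
Qed.

(* With a = y^3/x^3 and b = z^3/x^3 of order dividing 5 in the residue field,
   applying Frobenius to 1 + w a + w^2 b = 0 gives 1 + w/a + w^2/b = 0, and
   eliminating b leaves (a - 1)^2 = 0. *)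
Lemma veq_fermat12 x y z : x \in U -> y \in U -> z \in U ->
  fermat x y z = 0 -> veq (y ^+ 3) (x ^+ 3).
Proof.
move=> Ux Uy Uz e.
pose a := (y / x) ^+ 3; pose b := (z / x) ^+ 3.
have x0 := vunit_neq0 Ux.
have Ua : a \in U by rewrite vunitX ?vunitM ?vunitV.
have Ub : b \in U by rewrite vunitX ?vunitM ?vunitV.
have Va := vunitW Ua; have Vb := vunitW Ub.
have bE : b = - w - w ^+ 2 * a.
  apply/eqP; rewrite -subr_eq0; apply/eqP.
  transitivity (w * fermat x y z / x ^+ 3); last by rewrite e; ring.
  by rewrite /fermat /a /b; field: cube_root1.
have a5 : veq (a ^+ 5) 1.
  by rewrite -exprM (veq_exp15 totV half quad) ?vunitM ?vunitV.
have b5 : veq (b ^+ 5) 1.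
  by rewrite -exprM (veq_exp15 totV half quad) ?vunitM ?vunitV.
have h : 1 + w * a ^+ 4 + w ^+ 2 * b ^+ 4 \in m.
  have : veq ((1 + w * a + w ^+ 2 * b) ^+ 4)
      (1 + w * a ^+ 4 + w ^+ 2 * b ^+ 4).
    have -> : 1 + w * a ^+ 4 + w ^+ 2 * b ^+ 4 =
        1 ^+ 4 + (w * a) ^+ 4 + (w ^+ 2 * b) ^+ 4 by ring: cube_root1.
    have F4 := veq_frobenius half; apply: (veq_trans totV (F4 _ _ _ _)).
    - by in_ring.
    - by in_ring.
    by apply: (veqD totV (F4 _ _ _ _) (veqxx _ _)); in_ring.
  rewrite (_ : 1 + w * a + w ^+ 2 * b = 0); last by rewrite bE; ring: w2.
  by rewrite expr0n /= => /veqC; rewrite /veq subr0.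
have : (a - 1) ^+ 2 \in m.
  rewrite (_ : (a - 1) ^+ 2 = - w * (a * b * (1 + w * a ^+ 4 + w ^+ 2 * b ^+ 4)
     - w * b * (a ^+ 5 - 1) - w ^+ 2 * a * (b ^+ 5 - 1))); last first.
    rewrite (_ : _ - _ - _ = a * b + w * b + w ^+ 2 * a); last by ring.
    by rewrite bE; ring: w2.
  apply: vmaxMl; first by in_ring.
  apply: vmaxB => //; first apply: vmaxB => //.
  - by apply: vmaxMl => //; in_ring.
  - by apply: vmaxMl (a5); in_ring.
  - by apply: vmaxMl (b5); in_ring.
move/vmaxX => a1; rewrite /veq (_ : _ - _ = x ^+ 3 * (a - 1)); last first.
  by rewrite /a; field.
by rewrite vmaxMl ?rpredX ?a1 ?rpredB ?rpred1 // vunitW.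
Qed.

Lemma veq_fermat13 x y z : x \in U -> y \in U -> z \in U ->
  fermat x y z = 0 -> veq (z ^+ 3) (x ^+ 3).
Proof.
by move=> Ux Uy Uz /fermat_shift e; apply: veqC (veq_fermat12 Uz Ux Uy e).
Qed.

Definition unit_point (P : K * K * K) : Prop :=
  let: (x, y, z) := P in
  [/\ x \in U, y \in U, z \in U, fermat x y z = 0 & cusp x y z != 0].

(** Its square is -3, and 3 is a unit above 2. *)
Lemma vunit_sqrtN3 : 1 + 2 * w \in U.
Proof.
have := vunit_three totV half; apply: contraTT => nU.
have M : 1 + 2 * w \in m by apply: contraNT nU; apply: mem_vunit; in_ring.
have := vmax_exp totV (isT : (0 < 2)%N) M.
rewrite (_ : _ ^+ 2 = - 3); last by ring: w2.
by move=> /vmaxN; rewrite opprK; apply: contraL; apply: vmax_vunit.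
Qed.

(** Modulo the maximal ideal this is (w - w^2) y^3, and w - w^2 = 1 + 2 w. *)
Lemma vunit_cubeB x y : x \in U -> y \in U ->
  veq (x ^+ 3) (y ^+ 3) -> w * x ^+ 3 - w ^+ 2 * y ^+ 3 \in U.
Proof.
move=> Ux Uy xy.
rewrite (_ : _ - _ = (1 + 2 * w) * y ^+ 3 + w * (x ^+ 3 - y ^+ 3)); last first.
  by ring: w2.
by rewrite vunitDm ?vunitM ?vunitX ?vunit_sqrtN3 ?vmaxMl.
Qed.

Lemma vmax_cusp x y z : x \in U -> y \in U -> z \in U ->
  fermat x y z = 0 -> cusp x y z \in m.
Proof.
move=> Ux Uy Uz e.
rewrite (_ : cusp x y z = w ^+ 2 * (y ^+ 3 - x ^+ 3) + w * (z ^+ 3 - x ^+ 3));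
  last by rewrite /cusp; ring: w2.
apply: vmaxD => //; apply: vmaxMl; rewrite ?rpredX //.
  exact: (veq_fermat12 Ux Uy Uz e).
exact: (veq_fermat13 Ux Uy Uz e).
Qed.

Lemma vunit_cube_sum x y z : x \in U -> y \in U -> z \in U ->
  fermat x y z = 0 -> x ^+ 3 + y ^+ 3 + z ^+ 3 \in U.
Proof.
move=> Ux Uy Uz e.
rewrite (_ : _ + _ = 3 * x ^+ 3 + ((y ^+ 3 - x ^+ 3) + (z ^+ 3 - x ^+ 3)));
  last by ring.
apply: vunitDm => //; first by rewrite vunitM ?vunitX ?(vunit_three totV half).
apply: vmaxD => //; first exact: (veq_fermat12 Ux Uy Uz e).
exact: (veq_fermat13 Ux Uy Uz e).
Qed.

Definition cusp3 (P : K * K * K) : K := let: (x, y, z) := P in cusp x y z.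

(** Write p and p' for [cusp] at the point and at its image, and q for x^3 + y^3 + z^3. Then 9 p' =
    (1 + 2 w) p (p^3 + 2 q^3). As q is a unit and p^3 / 2 lies in the maximal ideal by
    [cube_div_two], the last factor is 2 times a unit. *)
Lemma unit_point_tangent P : unit_point P -> unit_point (tangent P) /\
  exists2 k, k \in U & cusp3 (tangent P) = 2 * k * cusp3 P.
Proof.
case: P => [[x y] z] [Ux Uy Uz e p0].
have x3 : x ^+ 3 = - (w * y ^+ 3) - w ^+ 2 * z ^+ 3.
  by apply/eqP; rewrite -subr_eq0 -[X in _ == X]e /fermat; apply/eqP; ring.
have xy := veqC (veq_fermat12 Ux Uy Uz e).
have xz := veqC (veq_fermat13 Ux Uy Uz e).
have yz := veq_trans totV (veqC xy) xz.
(* These three differences are the factors by which [tangent] multiplies the coordinates. *)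
have UBC := vunit_cubeB Uy Uz yz.
have UCA : w ^+ 2 * z ^+ 3 - x ^+ 3 \in U.
  rewrite (_ : _ - _ = w * (w * z ^+ 3 - w ^+ 2 * x ^+ 3)).
    by rewrite vunitM ?vunit_cubeB // veqC.
  by ring: cube_root1.
have UAB : x ^+ 3 - w * y ^+ 3 \in U.
  rewrite (_ : _ - _ = w ^+ 2 * (w * x ^+ 3 - w ^+ 2 * y ^+ 3)).
    by rewrite vunitM ?vunitX ?vunit_cubeB.
  by ring: cube_root1.
set p := cusp x y z in p0.
pose q := x ^+ 3 + y ^+ 3 + z ^+ 3.
have Mp : p \in m by apply: vmax_cusp.
have Uq : q \in U by apply: vunit_cube_sum e.
have n2 : (2 : K) != 0.
  by apply: contraNneq half => ->; rewrite invr0 rpred0.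
have n9 : (9 : K) != 0 by rewrite (natrM _ 3 3) 
    mulf_neq0 ?(vunit_neq0 (vunit_three totV half)).
pose k := (1 + 2 * w) / 9 * (q ^+ 3 + p ^+ 3 / 2).
have Uk : k \in U.
  rewrite /k (natrM _ 3 3) vunitM ?vunitDm ?vunitX ?cube_div_two //.
  by rewrite vunitM ?vunitV ?vunitM ?vunit_three ?vunit_sqrtN3.
have pk : cusp3 (tangent (x, y, z)) = 2 * k * p.
  apply: (mulfI n9); transitivity ((1 + 2 * w) * p * (p ^+ 3 + 2 * q ^+ 3)).
    rewrite /cusp3 /cusp /= /p /q /cusp; ring: x3 w2.
  by rewrite /k; field; rewrite n2 n9.
split; last by exists k.
rewrite /= in pk *; split; rewrite ?vunitM //.
  rewrite /fermat; ring: x3 w2.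
by rewrite pk; exact: mulf_neq0 (mulf_neq0 n2 (vunit_neq0 Uk)) p0.
Qed.

(** On the twisted cubic t^3 - 1 = - (p / (3 x y z))^3, where p is the value of [cusp]; cubing gives
    the ninth power. *)
Lemma hesse_disc_unit_point x y z : unit_point (x, y, z) ->
  exists2 k, k \in U & hesse_disc (hesse_parameter x y z) = k * cusp x y z ^+ 9.
Proof.
move=> [Ux Uy Uz e _].
have U3 := vunit_three totV half.
have [x0 y0 z0] := And3 (vunit_neq0 Ux) (vunit_neq0 Uy) (vunit_neq0 Uz).
have n3 := vunit_neq0 U3.
exists (- 27 / (3 * x * y * z) ^+ 9).
  rewrite (_ : - 27 = (- 3) ^+ 3); last by ring.
  rewrite vunitM ?vunitV ?vunitX ?vunitM // -mulN1r vunitM //.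
  by apply/vunitP; rewrite oppr_eq0 oner_eq0 invrN invr1 rpredN rpred1.
have x3 : x ^+ 3 = - (w * y ^+ 3) - w ^+ 2 * z ^+ 3.
  by apply/eqP; rewrite -subr_eq0 -[X in _ == X]e /fermat; apply/eqP; ring.
rewrite /hesse_disc; have -> : hesse_parameter x y z ^+ 3 - 1 =
    - (cusp x y z / (3 * x * y * z)) ^+ 3.
  rewrite /hesse_parameter expr_div_n.
  rewrite -[X in _ - X](@divff _ ((3 * x * y * z) ^+ 3)) ?expf_neq0 ?mulf_neq0 //.
  rewrite -mulrBl expr_div_n -[RHS]mulNr; congr (_ / _).
  by rewrite /cusp; ring: x3 w2.
by field; rewrite x0 y0 z0 n3.
Qed.

(** By [vunit_cube_sum] t is a unit, and t^3 is congruent to 1, so t^3 + 8 is congruent to the unit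
    9. *)
Lemma hesse_c4_unit_point x y z : unit_point (x, y, z) ->
  hesse_c4 (hesse_parameter x y z) \in U.
Proof.
move=> P; have [Ux Uy Uz e _] := P.
have U3 := vunit_three totV half.
set t := hesse_parameter x y z.
have Ut : t \in U.
  by rewrite vunitM ?vunit_cube_sum // vunitV // !vunitM.
have M : hesse_disc t \in m.
  have [k Uk ->] := hesse_disc_unit_point P.
  by rewrite vmaxMl ?vunitW // vmax_exp // vmax_cusp.
have {}M : t ^+ 3 - 1 \in m.
  have V1 : t ^+ 3 - 1 \in V by rewrite rpredB ?rpredX ?rpred1 ?vunitW.
  apply: (@vmaxX _ V _ 3) => //; move: M; rewrite /hesse_disc.
  rewrite (natrX _ 3 3); case/vmaxM/orP; rewrite ?rpredX ?rpred_nat //.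
  by rewrite (negPf (vmax_vunit (vunitX 3 U3))).
rewrite /hesse_c4 (natrM _ 3 3); clearbody t; rewrite !vunitM //.
rewrite (_ : t ^+ 3 + 8 = 3 * 3 + (t ^+ 3 - 1)); last by ring.
by rewrite vunitDm ?vunitM.
Qed.

Lemma iter_tangent P n : unit_point P -> unit_point (iter n tangent P) /\
  exists2 k, k \in U & cusp3 (iter n tangent P) = 2 ^+ n * k * cusp3 P.
Proof.
move=> UP; elim: n => [|n [Un [k Uk IH]]].
  by split=> //; exists 1; rewrite ?vunit1 // !mul1r.
have [US [k' Uk' e]] := unit_point_tangent Un.
split=> //; exists (k * k'); rewrite ?vunitM //=.
by rewrite e IH exprS; ring.
Qed.

End TwistedFermat.

(** * Parity in Q and Q(w), and quadratic relations over Q(w) *)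

Lemma int_parity (n : int) :
  (exists e : int, n = 2 * e) \/ (exists e : int, n = 1 + 2 * e).
Proof.
have n2 := divz_eq n 2; set q := (n %/ 2)%Z in n2; set r := (n %% 2)%Z in n2.
have [r0|r1] : r = 0 \/ r = 1 by rewrite /r; lia.
  by left; exists q; rewrite n2 r0 addr0 mulrC.
by right; exists q; rewrite n2 r1 addrC mulrC.
Qed.

(** Divisibility in a valuation ring is total, so some nonzero entry divides all others. It serves
    to normalize both projective coordinates and coefficients of linear relations. *)
Lemma max_valuation (K : fieldType) (V : subringClosed K) (s : seq K) :
    (forall x, (x \in V) || (x^-1 \in V)) -> has (predC1 0) s ->
  exists2 d, d \in s & d != 0 /\ forall x, x \in s -> x / d \in V.
Proof.
move=> totV; elim: s => //= x s IH.
have [/IH[d ds [d0 dP]] _|s0] := boolP (has (predC1 0) s); last first.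
  rewrite orbF => x0; exists x; rewrite ?inE ?eqxx //; split=> // y.
  rewrite inE => /predU1P[->|ys]; first by rewrite divff ?rpred1.
  suff -> : y = 0 by rewrite mul0r rpred0.
  by apply/eqP; apply: contraNT s0 => y0; apply/hasP; exists y.
case/orP: (totV (x / d)) => xd.
  exists d; rewrite ?inE ?ds ?orbT //; split=> // y.
  by rewrite inE => /predU1P[->|/dP].
have [x0|x0] := eqVneq x 0.
  exists d; rewrite ?inE ?ds ?orbT //; split=> // y.
  by rewrite inE => /predU1P[->|/dP //]; rewrite x0 mul0r rpred0.
exists x; rewrite ?inE ?eqxx //; split=> // y.
rewrite inE => /predU1P[->|/dP yd]; first by rewrite divff ?rpred1.
have -> : y / x = y / d * (x / d)^-1 by field; rewrite x0 d0.
exact: rpredM.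
Qed.

Section Quadratic.
Variables (K : fieldExtType rat) (V : subringClosed K).
Hypothesis totV : forall x, (x \in V) || (x^-1 \in V).
Hypothesis half : 2^-1 \notin V.
Local Notation m := (vmax V).
Local Notation U := (vunit V).
Local Notation f := (GRing.in_alg K).

Lemma vunit_odd (e : int) : ((1 + 2 * e)%:~R : K) \in U.
Proof.
rewrite intrD intrM vunitDm ?vunit1 // vmaxMr ?rpred_int //.
exact: vmax_two.
Qed.

(** A rational in [V] has odd denominator: otherwise its numerator would be odd, a unit, and yet a
    multiple of 2 in [V]. The parity of the numerator then decides. *)
Lemma rat_parity (r : rat) : f r \in V ->
  (exists2 s, f s \in V & r = 2 * s) \/ (exists2 s, f s \in V & r = 1 + 2 * s).
Proof.
have rE : r * (denq r)%:~R = (numq r)%:~R.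
  by rewrite -{1}[r]divq_num_den divfK // intr_eq0 denq_neq0.
move=> Vr; have d0 : (denq r)%:~R != 0 :> rat by rewrite intr_eq0 denq_neq0.
case: (int_parity (denq r)) => [[d dE]|[d dE]].
  case: (int_parity (numq r)) => [[e eE]|[e eE]].
    have := coprime_num_den r; rewrite eE dE !abszM /= /coprime -muln_gcdr.
    by rewrite muln_eq1.
  have := vmax_vunit (vunit_odd e); case/negP; rewrite -eE.
  rewrite -(rmorph_int f) -rE dE intrM !rmorphM mulrCA !rmorph_int.
  by apply: vmaxMr (vmax_two half); rewrite rpredM ?rpred_int.
have Vd (e : int) : f (e%:~R / (denq r)%:~R) \in V.
  have /vunitP[_ _ Wd] := vunit_odd d.
  by rewrite fmorph_div !rmorph_int dE rpredM ?rpred_int.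
case: (int_parity (numq r)) => [[e eE]|[e eE]]; [left|right].
  exists (e%:~R / (denq r)%:~R) => //.
  by rewrite -{1}[r]divq_num_den eE intrM mulrA.
exists ((e - d)%:~R / (denq r)%:~R) => //; apply: (mulIf d0).
rewrite rE eE [RHS]mulrDl mul1r -mulrA divfK // dE; ring.
Qed.

Variable w : K.
Hypothesis w2 : w ^+ 2 = - w - 1.

(** By the parities of r and s, the element r + s w is 0, w, 1 or - w^2 modulo 2. All four are fixed
    by the fourth power modulo 2, and only the first, where r and s are both even, is not a unit. *)
Lemma inert_pair (r s : rat) : f r \in V -> f s \in V ->
  inert V (f r + f s * w) /\
  (f r + f s * w \in m -> f r \in m /\ f s \in m).
Proof.
have Uw := vunit_cube_root w2 totV; have Vw := vunitW Uw.
have V2 : (2 : K) \in V := rpred_nat _ 2.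
have M2 : (2 : K) \in m := vmax_two half.
have n2 : (2 : K) != 0.
  by rewrite -invr_eq0; apply: contraNneq half => ->; rewrite rpred0.
have fdef (a : rat) : f (2 * a) = 2 * f a by rewrite rmorphM rmorph_nat.
have fodd (a : rat) : f (1 + 2 * a) = 1 + 2 * f a.
  by rewrite rmorphD rmorph1 rmorphM rmorph_nat.
move=> Vr Vs.
have inertU e a b : a \in V -> b \in V -> e \in U -> veq V (e ^+ 4) e ->
    inert V (e + 2 * (a + b * w)) /\ e + 2 * (a + b * w) \notin m.
  move=> Va Vb Ue e4.
  have Vab : a + b * w \in V by in_ring.
  have Um : e + 2 * (a + b * w) \in U by rewrite vunitDm ?vmaxMr.
  split; last exact: vmax_vunit Um.
  split; [exact: vunitW Um | | by rewrite (negPf (vmax_vunit Um))].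
  have Ve := vunitW Ue; move: (a + b * w) Vab Um => c Vc _.
  have V2c : 2 * c \in V by in_ring.
  apply: (veq_trans totV (veq_frobenius half Ve V2c)).
  apply: (veqD totV e4); rewrite /veq.
  rewrite (_ : _ - _ = 2 * (8 * c ^+ 4 - c)); last by ring.
  by apply: vmaxMr M2; in_ring.
case: (rat_parity Vr) => [[r' Vr' ->]|[r' Vr' ->]];
  case: (rat_parity Vs) => [[s' Vs' ->]|[s' Vs' ->]]; rewrite ?fdef ?fodd.
- split; last by rewrite !vmaxMr.
  rewrite (_ : _ + _ = 2 * (f r' + f s' * w)); last by ring.
  have Vc : f r' + f s' * w \in V by in_ring.
  move: (f r' + _) Vc => c Vc; split=> [| |_]; first by in_ring.
    rewrite /veq (_ : _ - _ = 2 * (8 * c ^+ 4 - c)); last by ring.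
    by apply: vmaxMr M2; in_ring.
  by rewrite mulrAC divff ?mul1r.
- rewrite (_ : 2 * f r' + (1 + 2 * f s') * w = w + 2 * (f r' + f s' * w));
    last by ring.
  have [] := inertU w _ _ Vr' Vs' Uw; last by move=> ? /negPf ->.
  by rewrite (_ : w ^+ 4 = w) ?veqxx //; ring: w2.
- rewrite (_ : 1 + 2 * f r' + 2 * f s' * w = 1 + 2 * (f r' + f s' * w));
    last by ring.
  have [] := inertU 1 _ _ Vr' Vs' (vunit1 V); last by move=> ? /negPf ->.
  by rewrite expr1n veqxx.
- rewrite (_ : 1 + 2 * f r' + (1 + 2 * f s') * w = (- w ^+ 2) + 2 * (f r' + f s' * w));
    last by rewrite w2; ring.
  have UwN : - w ^+ 2 \in U.
    rewrite -mulN1r vunitM ?vunitX //.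
    by apply/vunitP; rewrite oppr_eq0 oner_eq0 invrN invr1 rpredN rpred1.
  have [] := inertU _ _ _ Vr' Vs' UwN; last by move=> ? /negPf ->.
  rewrite /veq (_ : _ - _ = 2 * w ^+ 2); last by ring: (cube_root1 w2).
  by apply: vmaxMr M2; in_ring.
Qed.

(** The six elements 1, w, z, w z, z^2, w z^2 are dependent over Q. Dividing by the rational
    coefficient of least valuation makes one coefficient equal to 1, so by [inert_pair] the three
    grouped coefficients are not all in the maximal ideal. *)
Lemma inert_quadratic : (\dim {:K} <= 5)%N -> forall z, exists a b c,
  [/\ inert V a, inert V b, inert V c, a + b * z + c * z ^+ 2 = 0
  & [|| a \notin m, b \notin m | c \notin m]].
Proof.
move=> dimK z; pose X := [tuple 1; w; z; w * z; z ^+ 2; w * z ^+ 2].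
have nfX : ~~ free X.
  apply/negP; rewrite /free size_tuple => /eqP dX.
  by have := leq_trans (dimvS (subvf <<X>>)) dimK; rewrite dX.
have /existsNP[k /not_implyP[kX /existsNP[i0 /eqP ki0]]] := elimN freeP nfX.
pose s := [seq f (k i) | i <- enum 'I_6].
have fs i : f (k i) \in s by apply/mapP; exists i; rewrite ?mem_enum.
have /(max_valuation totV)[d /mapP[j _ ->] [j0 jP]] : has (predC1 0) s.
  apply/hasP; exists (f (k i0)); first exact: fs.
  by rewrite /= scaler_eq0 oner_eq0 orbF.
pose r (n : nat) := k (inord n) / k j.
have Vr n : f (r n) \in V by rewrite /r fmorph_div; apply/jP/fs.
have e : (f (r 0) + f (r 1) * w) + (f (r 2) + f (r 3) * w) * z
    + (f (r 4) + f (r 5) * w) * z ^+ 2 = 0.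
  have : (\sum_(i < 6) f (k (inord i)) * X`_i) / f (k j) = 0.
    suff -> : \sum_(i < 6) f (k (inord i)) * X`_i = 0 by rewrite mul0r.
    by apply: etrans kX; apply: eq_bigr => i _; rewrite inord_val mulr_algl.
  rewrite !big_ord_recl big_ord0 => <-; rewrite /r !fmorph_div /= /bump /=.
  ring.
exists (f (r 0) + f (r 1) * w), (f (r 2) + f (r 3) * w),
  (f (r 4) + f (r 5) * w).
have [a1 a2] := inert_pair (Vr 0) (Vr 1).
have [b1 b2] := inert_pair (Vr 2) (Vr 3).
have [c1 c2] := inert_pair (Vr 4) (Vr 5).
split=> //; apply: contraT => /norP[/negbNE Ma /norP[/negbNE Mb /negbNE Mc]].
have [[m0 m1] [m2 m3] [m4 m5]] := And3 (a2 Ma) (b2 Mb) (c2 Mc).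
suff : f (r j) \in m.
  have kj0 : k j != 0 by apply: contraNneq j0 => /= ->; rewrite scale0r.
  by rewrite /r inord_val divff // rmorph1 (negPf (vmax1 V)).
by move: (nat_of_ord j) (ltn_ord j); do 6?[case=> //].
Qed.

End Quadratic.

(** * Infinitely many points from one noncuspidal point *)

Lemma natr_neq0_rat (K : fieldExtType rat) (n : nat) : (n.+1%:R : K) != 0.
Proof.
by rewrite -(rmorph_nat (GRing.in_alg K)) fmorph_eq0 Num.Theory.pnatr_eq0.
Qed.

Lemma half_not_int (K : fieldExtType rat) (n : int) : n%:~R != 2%:R^-1 :> K.
Proof.
apply/eqP => e; have : (n * 2)%:~R = 1%:~R :> rat.
  apply: (fmorph_inj (GRing.in_alg K)); rewrite !rmorph_int intrM e.
  by rewrite mulVf // natr_neq0_rat.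
by move/intr_inj; lia.
Qed.

Definition hesse_parameter3 (K : fieldType) (P : K * K * K) : K :=
  let: (x, y, z) := P in hesse_parameter x y z.

(** The inequality separates the j-invariants c4^3 / Delta without dividing. Along iterated tangents
    from a normalized point, c4 stays a unit while Delta is a unit times (2^n p)^9. *)
Lemma infinite_fermat (K : fieldExtType rat) (w x y z : K) :
    (\dim {:K} <= 5)%N -> w ^+ 2 = - w - 1 -> x != 0 ->
    fermat w x y z = 0 -> cusp w x y z != 0 ->
  exists P : nat -> K * K * K,
    (forall n, let: (x, y, z) := P n in
       [/\ x != 0, y != 0, z != 0, fermat w x y z = 0 & cusp w x y z != 0]) /\
    (forall n n', (n < n')%N ->
       hesse_c4 (hesse_parameter3 (P n)) ^+ 3 *
         hesse_disc (hesse_parameter3 (P n')) !=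
       hesse_c4 (hesse_parameter3 (P n')) ^+ 3 *
         hesse_disc (hesse_parameter3 (P n))).
Proof.
move=> dimK w2 x0 e p0.
have [V [half totV]] := valuation_ring_exists (@half_not_int K).
have quad := inert_quadratic totV half w2 dimK.
have [|d ds [d0 dP]] := @max_valuation K V [:: x; y; z] totV.
  by rewrite /= x0.
have e' : fermat w (x / d) (y / d) (z / d) = 0.
  by rewrite -[RHS](mul0r (d ^+ 3)^-1) -e /fermat; field.
have p0' : cusp w (x / d) (y / d) (z / d) != 0.
  rewrite (_ : cusp _ _ _ _ = cusp w x y z / d ^+ 3).
    by rewrite mulf_neq0 // invr_eq0 expf_neq0.
  by rewrite /cusp; field.
pose P0 := (x / d, y / d, z / d).
have [Ux Uy Uz] : [/\ x / d \in vunit V, y / d \in vunit V & z / d \in vunit V].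
  have [Vx Vy Vz] : [/\ x / d \in V, y / d \in V & z / d \in V].
    by split; apply: dP; rewrite !inE eqxx ?orbT.
  apply: (vunit_fermat w2 totV half quad) e' => //; have U1 := vunit1 V.
  move: ds; rewrite !inE => /or3P[]/eqP dE; apply/or3P.
  - by constructor 1; rewrite -dE divff.
  - by constructor 2; rewrite -dE divff.
  - by constructor 3; rewrite -dE divff.
have UP : unit_point w V P0 by [].
exists (fun n => iter n (tangent w) P0); split=> [n|n n' ltnn'].

  have [] := iter_tangent w2 totV half quad n UP.
  by case: (iter n _ _) => [[a b] c] [Ua Ub Uc ? ?] _;
    rewrite (vunit_neq0 Ua) (vunit_neq0 Ub) (vunit_neq0 Uc).
pose t i := hesse_parameter3 (iter i (tangent w) P0).
have tE i : exists c k l, [/\ c \in vunit V, k \in vunit V, l \in vunit V,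
    hesse_c4 (t i) = c &
    hesse_disc (t i) = k * (2 ^+ i * l * cusp3 w P0) ^+ 9].
  have [] := iter_tangent w2 totV half quad i UP.
  rewrite /t /hesse_parameter3; case: (iter i _ _) => [[a b] c] Ui [l Ul pE].
  have [k Uk dE] := hesse_disc_unit_point w2 totV half Ui.
  exists (hesse_c4 (hesse_parameter a b c)), k, l; split=> //.
    exact: (hesse_c4_unit_point w2 totV half quad Ui).
  by rewrite dE -pE.
rewrite -/(t n) -/(t n').
have [c [k [l [Uc Uk Ul -> ->]]]] := tE n.
have [c' [k' [l' [Uc' Uk' Ul' -> ->]]]] := tE n'.
rewrite -(subnKC ltnn'); move: (n' - n.+1)%N => i.
set p := cusp3 w P0.
have q0 : (2 ^+ n * p) ^+ 9 != 0.
  by rewrite expf_neq0 // mulf_neq0 // expf_neq0 // natr_neq0_rat.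
apply/eqP => E.
(* Cancelling the common factor equates a unit with a multiple of 2, since n' = n + 1 + i. *)
have /(mulfI q0) : (2 ^+ n * p) ^+ 9 * (c' ^+ 3 * k * l ^+ 9) =
   (2 ^+ n * p) ^+ 9 * (c ^+ 3 * k' * l' ^+ 9 * (2 ^+ i.+1) ^+ 9).
  transitivity (c' ^+ 3 * (k * (2 ^+ n * l * p) ^+ 9)); first by ring.
  by rewrite -E addSnnS exprD; ring.
move=> E'; have : c' ^+ 3 * k * l ^+ 9 \in vunit V by rewrite !vunitM ?vunitX.
move/vmax_vunit; rewrite E' vmaxMl ?vunitW ?vunitM ?vunitX //.
by do 2!apply: vmax_exp => //; apply: vmax_two.
Qed.

(** * From points of the cubic to subgroups *)

Section ChordTangent.
Variables (F : fieldType) (W : weierstrass F).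
Local Notation a1 := (wa1 W).
Local Notation a2 := (wa2 W).
Local Notation a3 := (wa3 W).
Local Notation a4 := (wa4 W).
Local Notation a6 := (wa6 W).
Local Notation "x %:P y" := (Some (x, y)) (at level 0, only parsing).

Definition neg_point (P : option (F * F)) : option (F * F) :=
  if P is Some (x, y) then Some (x, - y - a1 * x - a3) else None.

Lemma neg_pointK : involutive neg_point.
Proof. by case=> [[x y]|] //=; congr (Some (_, _)); ring. Qed.

Lemma add_pointNr P : add_point W P (neg_point P) = None.
Proof.
case: P => [[x y]|] //=; rewrite eqxx.
by rewrite (_ : _ + _ + _ + _ = 0) ?eqxx //; ring.
Qed.

Lemma add_point0r P : add_point W P None = P.
Proof. by case: P => [[]|]. Qed.

Definition tangent_at (x y x' y' : F) : bool :=
  (2 * y + a1 * x + a3) * (y' - y) ==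
  (3 * x ^+ 2 + 2 * a2 * x + a4 - a1 * y) * (x' - x).

Lemma on_curve_same_x x y y' : on_curve W (Some (x, y)) ->
  on_curve W (Some (x, y')) -> y' = y \/ y' = - y - a1 * x - a3.
Proof.
move=> /eqP e /eqP e'; have /eqP : (y' - y) * (y' + y + a1 * x + a3) = 0.
  transitivity ((y' ^+ 2 + a1 * x * y' + a3 * y')
    - (y ^+ 2 + a1 * x * y + a3 * y)); first by ring.
  by rewrite e e' subrr.
rewrite mulf_eq0 subr_eq0 => /orP[/eqP|/eqP h]; [by left|right].
by apply/eqP; rewrite -subr_eq0 -h; apply/eqP; ring.
Qed.

Lemma add_point_chord x y x' y' x'' y'' :
    on_curve W (Some (x, y)) -> on_curve W (Some (x', y')) ->
    on_curve W (Some (x'', y'')) -> x != x' -> x'' != x -> x'' != x' ->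
    (y' - y) * (x'' - x) = (y'' - y) * (x' - x) ->
  add_point W (Some (x, y)) (Some (x', y')) = neg_point (Some (x'', y'')).
Proof.
move=> /eqP e /eqP e' /eqP e'' n n1 n2 col; rewrite /= (negPf n) /=.
have d : x' - x != 0 by rewrite subr_eq0 eq_sym.
set l := (y' - y) / (x' - x).
have yE : y' = y + l * (x' - x) by rewrite /l divfK // addrC subrK.
have yE2 : y'' = y + l * (x'' - x).
  apply: (mulIf d); rewrite mulrDl -[in RHS]mulrA [(x'' - x) * _]mulrC mulrA.
  by rewrite /l divfK // col; ring.
suff xE : l ^+ 2 + a1 * l - a2 - x - x' = x''.
  by rewrite xE /=; congr (Some (_, _)); rewrite yE2; ring.
(* Along the chord the curve equation becomes a monic cubic in the abscissa. Its second divided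
   difference at the three roots, cleared of denominators, is Vieta's formula for their sum. *)
have /eqP : (x' - x) * (x'' - x) * (x'' - x') *
    (x + x' + x'' + a2 - l ^+ 2 - a1 * l) = 0.
  pose g X Y := Y ^+ 2 + a1 * X * Y + a3 * Y -
    (X ^+ 3 + a2 * X ^+ 2 + a4 * X + a6).
  have [g1 g2 g3] : [/\ g x y = 0, g x' y' = 0 & g x'' y'' = 0].
    by rewrite /g e e' e'' !subrr.
  transitivity (g x y * (x' - x'') + g x' y' * (x'' - x) + g x'' y'' * (x - x')).
    by rewrite /g yE yE2; ring.
  by rewrite g1 g2 g3; ring.
rewrite !mulf_eq0 !subr_eq0 (negPf n1) (negPf n2) eq_sym (negPf n) /=.
by rewrite eq_sym => /eqP h; rewrite h; ring.
Qed.

(** The restriction to the tangent has x as a double root, so the sum of the roots is 2 x + x'. *)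
Lemma add_point_tangent x y x' y' :
    on_curve W (Some (x, y)) -> on_curve W (Some (x', y')) -> x' != x ->
    2 * y + a1 * x + a3 != 0 -> tangent_at x y x' y' ->
  add_point W (Some (x, y)) (Some (x, y)) = neg_point (Some (x', y')).
Proof.
move=> /eqP e /eqP e' n d /eqP tg; rewrite /= eqxx /=.
have -> : (y + y + a1 * x + a3 == 0) = false.
  by case: eqP => // h; case/eqP: d; rewrite -[RHS]h; ring.
set N := 3 * x ^+ 2 + 2 * a2 * x + a4 - a1 * y in tg *.
set M := 2 * y + a1 * x + a3 in d tg *.
pose l := N / M; rewrite -/l.
have lE : M * l = N by rewrite mulrC divfK.
have yE : y' = y + l * (x' - x).
  apply: (mulfI d); rewrite mulrDr mulrA lE -tg; ring.
suff xE : l ^+ 2 + a1 * l - a2 - x - x = x'.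
  by rewrite xE /=; congr (Some (_, _)); rewrite yE; ring.
have /eqP : (x' - x) ^+ 2 * (2 * x + x' + a2 - l ^+ 2 - a1 * l) = 0.
  pose g X Y := Y ^+ 2 + a1 * X * Y + a3 * Y -
    (X ^+ 3 + a2 * X ^+ 2 + a4 * X + a6).
  have [g1 g2] : g x y = 0 /\ g x' y' = 0 by rewrite /g e e' !subrr.
  transitivity (g x y - g x' y' + (M * l - N) * (x' - x)).
    by rewrite /g yE /M /N; ring.
  by rewrite g1 g2 lE; ring.
rewrite !mulf_eq0 !subr_eq0 (negPf n) /=.
by rewrite eq_sym => /eqP h; rewrite h; ring.
Qed.

Lemma add_point_chord_tangent x y x' y' :
    on_curve W (Some (x, y)) -> on_curve W (Some (x', y')) -> x' != x ->
    tangent_at x y x' y' ->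
  add_point W (Some (x, y)) (Some (x', y')) = neg_point (Some (x, y)).
Proof.
move=> /eqP e /eqP e' n /eqP tg; rewrite /= eq_sym (negPf n) /=.
have d : x' - x != 0 by rewrite subr_eq0.
set N := 3 * x ^+ 2 + 2 * a2 * x + a4 - a1 * y in tg.
set M := 2 * y + a1 * x + a3 in tg.
set l := (y' - y) / (x' - x).
have yE : y' = y + l * (x' - x) by rewrite /l divfK // addrC subrK.
have lE : M * l = N by apply: (mulIf d); rewrite -tg yE; ring.
suff xE : l ^+ 2 + a1 * l - a2 - x - x' = x.
  by rewrite xE /=; congr (Some (_, _)); ring.
have /eqP : (x' - x) ^+ 2 * (2 * x + x' + a2 - l ^+ 2 - a1 * l) = 0.
  pose g X Y := Y ^+ 2 + a1 * X * Y + a3 * Y -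
    (X ^+ 3 + a2 * X ^+ 2 + a4 * X + a6).
  have [g1 g2] : g x y = 0 /\ g x' y' = 0 by rewrite /g e e' !subrr.
  transitivity (g x y - g x' y' + (M * l - N) * (x' - x)).
    by rewrite /g yE /M /N; ring.
  by rewrite g1 g2 lE; ring.
rewrite !mulf_eq0 (negPf d) /= => /eqP h.
by apply/eqP; rewrite -subr_eq0 -oppr_eq0 -h; apply/eqP; ring.
Qed.

(** The tangent slope is computed from the first argument only; there the curve equations force the
    two points to coincide. *)
Lemma add_pointC P Q : on_curve W P -> on_curve W Q ->
  add_point W P Q = add_point W Q P.
Proof.
case: P Q => [[x y]|] [[x' y']|] // e e'.
have [xx|n] := eqVneq x x'.
  subst x'; rewrite /= !eqxx /=.
  have -> : y' + y + a1 * x + a3 = y + y' + a1 * x + a3 by ring.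
  case: eqP => // n; suff -> : y' = y by [].
  by have [//|h] := on_curve_same_x e e'; case: n; rewrite h; ring.
rewrite /= (negPf n) [x' == x]eq_sym (negPf n) /=.
have d : x' - x != 0 by rewrite subr_eq0 eq_sym.
have -> : (y - y') / (x - x') = (y' - y) / (x' - x).
  by rewrite -[y - y']opprB -[x - x']opprB invrN mulrNN.
set l := (y' - y) / (x' - x).
have yE : y' = y + l * (x' - x) by rewrite /l divfK // addrC subrK.
by congr (Some (_, _)); rewrite ?yE; ring.
Qed.

End ChordTangent.

(** * The Hesse cubic and its Weierstrass model *)

Section Hesse.
Variables (F : fieldType) (w t : F).
Hypotheses (w2 : w ^+ 2 = - w - 1) (n3 : (3 : F) != 0) (t3 : t ^+ 3 != 1).
Local Notation a := (t ^+ 3 - 1).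

Definition hesse_curve : weierstrass F := Weierstrass (3 * t) 0 a 0 0.
Local Notation W := hesse_curve.

Definition on_hesse (P : F * F * F) : Prop :=
  let: (x, y, z) := P in x ^+ 3 + y ^+ 3 + z ^+ 3 = 3 * t * x * y * z.

Definition line_inf (P : F * F * F) : F :=
  let: (x, y, z) := P in t * x + w * y + w ^+ 2 * z.

(* The three flex tangents t x + w^i y + w^2i z of the Hesse cubic
   x^3 + y^3 + z^3 = 3 t x y z multiply to (t^3 - 1) x^3 on it; this is the
   Weierstrass equation, with t x + w y + w^2 z as the line at infinity. *)
Definition to_weierstrass (P : F * F * F) : option (F * F) :=
  let: (x, y, z) := P in
  if line_inf P == 0 then None
  else Some (- a * x / line_inf P,
             a * (t * x + w ^+ 2 * y + w * z) / line_inf P).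

(** In this scaling the three flex tangent forms take the values [e], [- a] and [- y], with sum 3 t
    x; the last two coordinates come from inverting the Fourier transform of order 3. *)
Definition of_weierstrass (x y : F) : F * F * F :=
  let e := y + 3 * t * x + a in
  (x, (e - w * y - w ^+ 2 * a) / 3, (e - w ^+ 2 * y - w * a) / 3).

Definition scale3 (k : F) (P : F * F * F) : F * F * F :=
  let: (x, y, z) := P in (k * x, k * y, k * z).

Definition det3 (P Q R : F * F * F) : F :=
  let: (x, y, z) := P in let: (x', y', z') := Q in let: (x'', y'', z'') := R in
  x * (y' * z'' - z' * y'') - y * (x' * z'' - z' * x'')
  + z * (x' * y'' - y' * x'').

(** A third of the gradient of the Hesse cubic at [P], paired with [Q]: it vanishes when [Q] is on
    the tangent at [P]. *)
Definition polar (P Q : F * F * F) : F :=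
  let: (x, y, z) := P in let: (x', y', z') := Q in
  (x ^+ 2 - t * y * z) * x' + (y ^+ 2 - t * x * z) * y'
  + (z ^+ 2 - t * x * y) * z'.

Definition coord_prod (P : F * F * F) : F := let: (x, y, z) := P in x * y * z.

(** Negation for the origin (0 : 1 : -w^2): it preserves the line at infinity and exchanges the
    other two flex tangents. *)
Definition opp_hesse (P : F * F * F) : F * F * F :=
  let: (x, y, z) := P in (x, w * z, w ^+ 2 * y).

Let a0 : a != 0. Proof. by rewrite subr_eq0. Qed.

Let w3 := cube_root1 w2.

Lemma of_weierstrassK P p : to_weierstrass P = Some p ->
  exists2 k, k != 0 & of_weierstrass p.1 p.2 = scale3 k P.
Proof.
case: P => [[x y] z]; rewrite /to_weierstrass; case: eqVneq => // d [<-] /=.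
rewrite /line_inf in d *.
exists (- a / (t * x + w * y + w ^+ 2 * z)).
  by rewrite mulf_neq0 ?invr_eq0 ?oppr_eq0.
congr (_, _, _); first by field.
  by field: w2; rewrite n3 d.
by field: w2; rewrite n3 d.
Qed.

Lemma on_curve_to_weierstrass P : on_hesse P -> on_curve W (to_weierstrass P).
Proof.
case: P => [[x y] z]; rewrite /to_weierstrass; case: eqVneq => // d e.
rewrite /on_curve /= /line_inf in e d *.
set D := t * x + w * y + w ^+ 2 * z in d *.
apply/eqP/(mulIf (expf_neq0 3 d)).
set M := t * x + w ^+ 2 * y + w * z.
transitivity (a ^+ 2 * M * D * (M - 3 * t * x + D)); first by field.
transitivity (- a ^+ 3 * x ^+ 3); last by field.
apply/eqP; rewrite -subr_eq0.
rewrite (_ : _ - _ = - a ^+ 2 *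
  (x ^+ 3 + y ^+ 3 + z ^+ 3 - 3 * t * x * y * z)).
  by rewrite e subrr mulr0.
by rewrite /M /D; ring: w2.
Qed.

Lemma to_weierstrass_opp P :
  to_weierstrass (opp_hesse P) = neg_point W (to_weierstrass P).
Proof.
case: P => [[x y] z]; rewrite /to_weierstrass /=.
have -> : t * x + w * (w * z) + w ^+ 2 * (w ^+ 2 * y)
  = t * x + w * y + w ^+ 2 * z by ring: w3.
case: eqVneq => //= d; congr (Some (_, _)).
by field: w2.
Qed.

Lemma to_weierstrass_scale k P : k != 0 ->
  to_weierstrass (scale3 k P) = to_weierstrass P.
Proof.
case: P => [[x y] z] k0; rewrite /to_weierstrass /=.
have -> : t * (k * x) + w * (k * y) + w ^+ 2 * (k * z)
  = k * (t * x + w * y + w ^+ 2 * z) by ring.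
rewrite mulf_eq0 (negPf k0) /=; case: eqVneq => //= d.
by congr (Some (_, _)); field; rewrite k0 d.
Qed.

Lemma to_weierstrass_inj P Q : on_hesse P -> on_hesse Q ->
    P != (0, 0, 0) -> Q != (0, 0, 0) ->
    to_weierstrass P = to_weierstrass Q ->
  exists2 k, k != 0 & Q = scale3 k P.
Proof.
move=> hP hQ P0 Q0.
case EP : (to_weierstrass P) => [p|] EQ.
  have [k k0 kP] := of_weierstrassK EP.
  have [l l0] := of_weierstrassK (esym EQ); rewrite kP => e.
  exists (k / l); first by rewrite mulf_neq0 ?invr_eq0.
  move: e; case: (P) (Q) => [[x y] z] [[x' y'] z'] [e1 e2 e3].
  by congr (_, _, _); apply: (mulfI l0); rewrite -?e1 -?e2 -?e3; field.
(* The line at infinity is a flex tangent: on it (t^3 - 1) x^3 = 0, which leaves the single point (0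
   : -w : 1). *)
have inf R : on_hesse R -> R != (0, 0, 0) -> None = to_weierstrass R ->
    exists2 k, k != 0 & R = (0, - (w * k), k).
  case: R => [[x y] z] e R0; rewrite /to_weierstrass; case: eqVneq => // d _.
  have x0 : x = 0.
    apply/eqP; have /eqP : a * x ^+ 3 = 0.
      transitivity ((t * x + y + z) * (t * x + w ^+ 2 * y + w * z) *
         line_inf (x, y, z)); last by rewrite d mulr0.
      have -> : a * x ^+ 3 = t ^+ 3 * x ^+ 3 + y ^+ 3 + z ^+ 3
          - 3 * t * x * y * z by rewrite -e; ring.
      by rewrite /line_inf; ring: w2.
    by rewrite mulf_eq0 (negPf a0) expf_eq0.
  have yE : y = - (w * z).
    apply/eqP; rewrite -subr_eq0 opprK; apply/eqP.
    transitivity (w ^+ 2 * line_inf (x, y, z)); last by rewrite d mulr0.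
    by rewrite /line_inf x0; ring: w3.
  exists z; last by rewrite x0 yE.
  by apply: contraNneq R0 => z0; rewrite x0 yE z0 mulr0 oppr0.
have [k k0 ->] := inf P hP P0 (esym EP).
have [l l0 ->] := inf Q hQ Q0 EQ.
exists (l / k); first by rewrite mulf_neq0 ?invr_eq0.
by congr (_, _, _); field.
Qed.

(** [of_weierstrass] is a projective change of coordinates whose determinant, up to sign, is the
    nonzero constant [c0] of the proof. *)
Lemma det3_collinear x y x' y' x'' y'' :
    det3 (of_weierstrass x y) (of_weierstrass x' y') (of_weierstrass x'' y'')
      = 0 ->
  (y' - y) * (x'' - x) = (y'' - y) * (x' - x).
Proof.
move=> e; have w10 : 1 + 2 * w != 0.
  suff : (1 + 2 * w) ^+ 2 != 0 by rewrite expf_eq0.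
  by rewrite (_ : _ ^+ 2 = - 3) ?oppr_eq0 //; ring: w2.
apply/eqP; rewrite -subr_eq0; apply/eqP.
have c0 : (1 + 2 * w) * a / 3 != 0 by rewrite !mulf_neq0 ?invr_eq0.
apply: (mulfI c0); rewrite [RHS]mulr0 -[RHS]e /det3 /of_weierstrass.
by field: w2.
Qed.

Lemma polar_tangent x y x' y' : on_curve W (Some (x, y)) ->
  polar (of_weierstrass x y) (of_weierstrass x' y') = 0 ->
  tangent_at W x y x' y'.
Proof.
move=> /eqP /= e p; rewrite /tangent_at /= -subr_eq0; apply/eqP.
apply: (mulfI a0); rewrite [RHS]mulr0 -[RHS](mulr0 3) -[in RHS]p.
rewrite /polar /of_weierstrass.
have x3 : x ^+ 3 = y ^+ 2 + 3 * t * x * y + a * y.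
  by rewrite e; ring.
by field: w2 x3.
Qed.

Lemma polar_scale k l P Q :
  polar (scale3 k P) (scale3 l Q) = k ^+ 2 * l * polar P Q.
Proof. by case: P Q => [[x y] z] [[x' y'] z'] /=; ring. Qed.

Lemma det3_scale k l m P Q R :
  det3 (scale3 k P) (scale3 l Q) (scale3 m R) = k * l * m * det3 P Q R.
Proof. by case: P Q R => [[? ?] ?] [[? ?] ?] [[? ?] ?] /=; ring. Qed.

(* On the Hesse cubic the flexes are cut out by x y z = 0. *)
Lemma add_point_flex x y : on_curve W (Some (x, y)) ->
    coord_prod (of_weierstrass x y) = 0 ->
    2 * y + 3 * t * x + a != 0 ->
  add_point W (Some (x, y)) (Some (x, y)) = neg_point W (Some (x, y)).
Proof.
move=> /eqP e p d; rewrite /= in e *; rewrite eqxx /=.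
have -> : (y + y + 3 * t * x + a == 0) = false.
  by case: eqP => // h; case/eqP: d; rewrite -[RHS]h; ring.
set N := 3 * x ^+ 2 + 2 * 0 * x + 0 - 3 * t * y.
set M := 2 * y + 3 * t * x + a in d *.
set l := N / M.
have x3 : x ^+ 3 = y ^+ 2 + 3 * t * x * y + a * y.
  by rewrite e; ring.
suff xE : l ^+ 2 + 3 * t * l - 0 - x - x = x.
  by rewrite xE; congr (Some (_, _)); ring.
have /eqP : 9 * (coord_prod (of_weierstrass x y)) = 0 by rewrite p mulr0.
(* The right-hand side, divided by - M^2, is l^2 + 3 t l - 3 x; its vanishing says that the tangent
   meets the curve a third time at the same abscissa. *)
have -> : 9 * coord_prod (of_weierstrass x y) =
    - (N ^+ 2 + 3 * t * N * M - 3 * x * M ^+ 2).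
  by rewrite /coord_prod /of_weierstrass /N /M; field: w2 x3.
rewrite oppr_eq0 => /eqP h; apply/eqP; rewrite -subr_eq0; apply/eqP.
apply: (mulfI (expf_neq0 2 d)); rewrite [RHS]mulr0 -[RHS]h /l.
by field.
Qed.

End Hesse.

Section HesseSubgroup.
Variables (F : fieldType) (w t : F).
Hypotheses (w2 : w ^+ 2 = - w - 1) (n3 : (3 : F) != 0) (t3 : t ^+ 3 != 1).
Variables (A : zmodType) (h : A -> F * F * F).
Local Notation W := (hesse_curve t).
Local Notation p := (fun g => to_weierstrass w t (h g)).
Hypothesis h_hesse : forall g, on_hesse t (h g).
Hypothesis p_inj : injective p.
Hypothesis p0 : p 0 = None.
Hypothesis pN : forall g, p (- g) = neg_point W (p g).
Hypothesis h_det : forall g g', det3 (h g) (h g') (h (- (g + g'))) = 0.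
Hypothesis h_tangent : forall g, polar t (h g) (h (- (g + g))) = 0.
Hypothesis h_flex : forall g, g + g + g = 0 -> coord_prod (h g) = 0.

(** The elements [g], [g'] and [- (g + g')] have sum zero. Away from zero and opposite pairs, three
    distinct ones lie on a chord by [h_det], two equal ones on a tangent by [h_tangent], and three
    equal ones form a flex by [h_flex]. *)
Lemma hesse_subgroup : has_subgroup_isog W A.
Proof.
exists p; split=> // [g|g g']; first exact/(on_curve_to_weierstrass w2)/h_hesse.
have pon g1 : on_curve W (p g1).
  exact/(on_curve_to_weierstrass w2)/h_hesse.
have [->|g0] := eqVneq g 0; first by rewrite add0r p0.
have [->|g'0] := eqVneq g' 0; first by rewrite addr0 p0 add_point0r.
have [e|gg0] := eqVneq (g + g') 0.
  have -> : g' = - g by apply/eqP; rewrite -addr_eq0 addrC e.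
  by rewrite subrr p0 pN add_pointNr.
set g'' := - (g + g').
have -> : g + g' = - g'' by rewrite opprK.
rewrite pN.
have g''0 : g'' != 0 by rewrite oppr_eq0.
have pS g1 : g1 != 0 -> exists x y k, [/\ p g1 = Some (x, y), k != 0 &
    of_weierstrass w t x y = scale3 k (h g1)].
  move=> g10; case E : (p g1) => [[x y]|]; last first.
    by case/eqP: g10; apply: p_inj; rewrite E p0.
  have [k k0 kE] := of_weierstrassK w2 n3 t3 E.
  by exists x, y, k.
have px g1 g2 x y x' y' : p g1 = Some (x, y) -> p g2 = Some (x', y') ->
    g2 != g1 -> g1 + g2 != 0 -> x' != x.
  move=> E1 E2 n12 n0; apply/eqP => ex; subst x'.
  have := pon g1; have := pon g2; rewrite E1 E2 => c2 c1.
  case: (on_curve_same_x c1 c2) => ey.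
    by case/eqP: n12; apply: p_inj; rewrite E1 E2 ey.
  case/eqP: n0; apply/eqP; rewrite addrC addr_eq0; apply/eqP/p_inj.
  by rewrite pN E1 E2 ey.
have sum3 : g + g' + g'' = 0 by rewrite subrr.
have n12 : g + g' != 0 by [].
have n13 : g + g'' != 0.
  by apply: contra g'0 => /eqP e; rewrite -sum3 addrAC e add0r.
have n23 : g' + g'' != 0.
  by apply: contra g0 => /eqP e; rewrite -sum3 -addrA e addr0.
have [x [y [k [E k0 kE]]]] := pS g g0.
have [x' [y' [k' [E' k'0 kE']]]] := pS g' g'0.
have [x'' [y'' [k'' [E'' k''0 kE'']]]] := pS g'' g''0.
have [c c' c''] : [/\ on_curve W (Some (x, y)), on_curve W (Some (x', y'))
    & on_curve W (Some (x'', y''))] by rewrite -E -E' -E''.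
rewrite E E' E''; apply: esym.
have tang g1 g2 x1 y1 x2 y2 k1 k2 : on_curve W (Some (x1, y1)) ->
    g2 = - (g1 + g1) ->
    of_weierstrass w t x1 y1 = scale3 k1 (h g1) ->
    of_weierstrass w t x2 y2 = scale3 k2 (h g2) -> tangent_at W x1 y1 x2 y2.
  move=> c1 -> e1 e2; apply: (polar_tangent w2 n3 t3 c1).
  by rewrite e1 e2 polar_scale h_tangent mulr0.
have [eg|ng] := eqVneq g' g.
  have [ex ey] : x' = x /\ y' = y.
    by move: E'; rewrite eg E => -[-> ->].
  subst x' y'.
  have d : 2 * y + 3 * t * x + (t ^+ 3 - 1) != 0.
    apply/eqP => d; case/eqP: n12; apply/eqP; rewrite addr_eq0; apply/eqP/p_inj.
    rewrite pN E' E /=; congr (Some (_, _)).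
    by rewrite -[LHS]subr0 -d; ring.
  have [eg''|ng''] := eqVneq g'' g.
    have [-> ->] : x'' = x /\ y'' = y.
      by move: E''; rewrite eg'' E => -[-> ->].
    apply: (add_point_flex w2 n3 c _ d).
    rewrite kE; have := h_flex; move/(_ g); rewrite -{3}eg'' -{2}eg sum3.
    move=> /(_ erefl); case: (h g) => [[X Y] Z] /= XYZ.
    transitivity (k ^+ 3 * (X * Y * Z)); first by ring.
    by rewrite XYZ mulr0.
  apply: add_point_tangent => //; first exact: px E E'' ng'' n13.
  by apply: tang kE kE'' => //; rewrite /g'' eg.
have nx : x' != x by apply: px E E' ng n12.
have [eg''|ng''] := eqVneq g'' g.
  have [-> ->] : x'' = x /\ y'' = y.
    by move: E''; rewrite eg'' E => -[-> ->].
  apply: add_point_chord_tangent => //.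
  apply: tang kE kE' => //; apply/eqP; rewrite -addr_eq0 -[X in g' + (_ + X)]eg''.
  by rewrite addrCA addrA sum3.
have [eg''|ng'''] := eqVneq g'' g'.
  have [-> ->] : x'' = x' /\ y'' = y'.
    by move: E''; rewrite eg'' E' => -[-> ->].
  rewrite add_pointC //; apply: add_point_chord_tangent => //.
    by rewrite eq_sym.
  apply: tang kE' kE => //; apply/eqP; rewrite -addr_eq0 -[X in g + (_ + X)]eg''.
  by rewrite addrA sum3.
apply: add_point_chord => //; first by rewrite eq_sym.
- exact: px E E'' ng'' n13.
- exact: px E' E'' ng''' n23.
apply: (det3_collinear w2 n3 t3).
by rewrite kE kE' kE'' det3_scale h_det mulr0.
Qed.

End HesseSubgroup.

(** * Explicit points: translates of 0, Q and -Q by 3-torsion *)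

Section NinthDivision.
Variables (F : fieldType) (w x y z : F).
Hypotheses (w2 : w ^+ 2 = - w - 1) (n3 : (3 : F) != 0).
Hypotheses (x0 : x != 0) (y0 : y != 0) (z0 : z != 0).
Hypotheses (e : fermat w x y z = 0) (c0 : cusp w x y z != 0).
Let t := hesse_parameter x y z.

Let w3 := cube_root1 w2.
Let x3 : x ^+ 3 = - (w * y ^+ 3) - w ^+ 2 * z ^+ 3.
Proof.
by apply/eqP; rewrite -subr_eq0 -[X in _ == X]e /fermat; apply/eqP; ring.
Qed.

(* The origin, a point Q of order 9, and -Q. *)
Definition base (c : nat) : F * F * F :=
  match c with
  | 0 => (0, 1, - w ^+ 2)
  | 1 => (x, y, z)
  | _ => (x, w * z, w ^+ 2 * y)
  end.

Definition shift3 (i : nat) (P : F * F * F) : F * F * F :=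
  let: (x, y, z) := P in
  match i with 0 => (x, y, z) | 1 => (y, z, x) | _ => (z, x, y) end.

Definition diag3 (a : F) (P : F * F * F) : F * F * F :=
  let: (x, y, z) := P in (x, a * y, a ^+ 2 * z).

(** The 3-torsion acts on the point indexed by [c] through cyclic shifts and the matrices diag(1, a,
    a^2) with a^3 = 1. *)
Definition ninth (i : nat) (a : F) (c : nat) : F * F * F :=
  shift3 i (diag3 a (base c)).

(** As 2 stands for -Q, one has -(Q + Q) = Q - 3Q and -(-Q - Q) = -Q + 3Q; the entries [w] and
    [w ^+ 2] are the diagonal parameters of -3Q and 3Q. *)
Definition carry (c c' : nat) : F :=
  match c, c' with 1, 1 => w | 2, 2 => w ^+ 2 | _, _ => 1 end.




Let w0 : w != 0.
Proof. by apply: contra_eq_neq w3 => ->; rewrite expr0n eq_sym oner_eq0. Qed.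

Lemma cube_neq : [/\ x ^+ 3 != y ^+ 3, y ^+ 3 != z ^+ 3 & x ^+ 3 != z ^+ 3].
Proof.
have yz : y ^+ 3 != z ^+ 3.
  apply: contraNneq c0 => yz.
  have -> : cusp w x y z = (w ^+ 2 - w) * (y ^+ 3 - z ^+ 3).
    by rewrite /cusp; ring: x3.
  by rewrite yz subrr mulr0.
split=> //; apply: contraNneq yz => h; rewrite -subr_eq0.
  have /eqP : - w ^+ 2 * (y ^+ 3 - z ^+ 3) = 0 by rewrite -e /fermat h; ring: w2.
  by rewrite mulf_eq0 oppr_eq0 expf_eq0 (negPf w0).
have /eqP : w * (y ^+ 3 - z ^+ 3) = 0 by rewrite -e /fermat h; ring: w2.
by rewrite mulf_eq0 (negPf w0).
Qed.

Lemma hesse_parameter_cube : t ^+ 3 != 1.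
Proof.
have d0 : (3 * x * y * z) ^+ 3 != 0 by rewrite expf_neq0 // !mulf_neq0.
rewrite -subr_eq0 /t /hesse_parameter expr_div_n.
have -> : (x ^+ 3 + y ^+ 3 + z ^+ 3) ^+ 3 / (3 * x * y * z) ^+ 3 - 1 =
    - (cusp w x y z ^+ 3 / (3 * x * y * z) ^+ 3).
  apply: (mulIf d0); rewrite mulrBl mul1r mulNr !divfK //.
  by rewrite /cusp; ring: x3 w2.
by rewrite oppr_eq0 mulf_neq0 ?invr_eq0 // expf_neq0.
Qed.

(** The third point is minus the sum of the others: negation in Z/3 is doubling, and squaring
    inverts a cube root of unity. Each choice of indices is an identity modulo four relations. *)
Lemma det3_ninth i i' c c' a a' : (i < 3)%N -> (i' < 3)%N -> (c < 3)%N ->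
    (c' < 3)%N -> a ^+ 3 = 1 -> a' ^+ 3 = 1 ->
  det3 (ninth i a c) (ninth i' a' c')
    (ninth ((i + i').*2 %% 3) (a ^+ 2 * a' ^+ 2 * carry c c')
       ((c + c').*2 %% 3)) = 0.
Proof.
move=> hi hi' hc hc' ha ha'.
by case: i i' c c' hi hi' hc hc'
  => [|[|[|//]]] [|[|[|//]]] [|[|[|//]]] [|[|[|//]]] _ _ _ _;
  rewrite /ninth /shift3 /diag3 /base /carry /=; ring: w2 ha ha' x3.
Qed.

(** Since -2 = 1 in Z/3, the residual point of the tangent keeps the indices [i] and [c]. *)
Lemma polar_ninth i c a : (i < 3)%N -> (c < 3)%N -> a ^+ 3 = 1 ->
  polar t (ninth i a c) (ninth i (a ^+ 4 * carry c c) c) = 0.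
Proof.
move=> hi hc ha.
by case: i c hi hc => [|[|[|//]]] [|[|[|//]]] _ _;
  rewrite /polar /ninth /shift3 /diag3 /base /carry /=; ring: w2 ha x3.
Qed.

Lemma on_hesse_ninth i a c : a ^+ 3 = 1 -> on_hesse t (ninth i a c).
Proof.
move=> ha; have zE : z ^+ 3 = 3 * t * x * y * z - x ^+ 3 - y ^+ 3.
  by rewrite /t /hesse_parameter; field; rewrite n3 x0 y0 z0.
case: i c => [|[|i]] [|[|c]]; rewrite /on_hesse /ninth /shift3 /diag3 /base;
  ring: w2 ha zE.
Qed.

Lemma coord_prod_ninth i a : coord_prod (ninth i a 0) = 0.
Proof. by case: i => [|[|i]]; rewrite /coord_prod /=; ring. Qed.

Lemma opp_ninth i a c : (i < 3)%N -> (c < 3)%N -> a ^+ 3 = 1 ->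
  exists2 k, k != 0 & ninth (i.*2 %% 3) (a ^+ 2) (c.*2 %% 3)
                      = scale3 k (opp_hesse w (ninth i a c)).
Proof.
move=> hi hc ha.
(* The sign appears because [opp_hesse] negates the coordinates of the origin; the power of [w]
   comes from moving the shift past its diagonal factor. *)
exists ((if c is 0 then -1 else 1) * w ^+ i.*2).
  by rewrite mulf_neq0 ?expf_neq0 //; case: (c); rewrite ?oppr_eq0 oner_eq0.
by case: i c hi hc => [|[|[|//]]] [|[|[|//]]] _ _;
  rewrite /ninth /shift3 /diag3 /base /opp_hesse /scale3 /=;
  congr (_, _, _); ring: w2 ha.
Qed.

(** The product of coordinates separates [c = 0] from the rest. The cubes of the coordinates forget
    [a] and determine [i] and [c], because x^3, y^3, z^3 are distinct; comparing coordinates then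
    recovers [a]. *)
Lemma scale3_ninth k i i' c c' a a' : k != 0 ->
    (i < 3)%N -> (i' < 3)%N -> (c < 3)%N -> (c' < 3)%N ->
    a ^+ 3 = 1 -> a' ^+ 3 = 1 ->
    ninth i' a' c' = scale3 k (ninth i a c) -> [/\ i = i', a = a' & c = c'].
Proof.
move=> k0 hi hi' hc hc' ha ha' E.
have [/eqP xy /eqP yz /eqP xz] := cube_neq.
have n0 (b : F) : b ^+ 3 = 1 -> b != 0.
  by apply: contra_eq_neq => ->; rewrite expr0n eq_sym oner_eq0.
have coord_prod_ninthS j b d : b ^+ 3 = 1 ->
    coord_prod (ninth j b d.+1) = x * y * z.
  by case: j d => [|[|j]] [|d] h;
    rewrite /coord_prod /ninth /shift3 /diag3 /base /=; ring: w2 h.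
have inj3 (X Y Z X' Y' Z' : F) : (X, Y, Z) = (X', Y', Z') ->
    [/\ X = X', Y = Y' & Z = Z'] by case.
have xyz0 : x * y * z != 0 by rewrite !mulf_neq0.
have Pk : coord_prod (ninth i' a' c') = k ^+ 3 * coord_prod (ninth i a c).
  by rewrite E; case: (ninth i a c) => [[X Y] Z] /=; ring.
have k3 : (0 < c)%N -> (0 < c')%N -> k ^+ 3 = 1.
  case: c c' Pk {hc hc' E} => [//|c] [//|c'].
  by rewrite !coord_prod_ninthS // => h _ _; apply: (mulIf xyz0); rewrite -h mul1r.
have cc : (c == 0) = (c' == 0).
  case: c c' Pk {hc hc' E k3} => [|c] [|c'] //;
    rewrite ?coord_prod_ninth ?coord_prod_ninthS // ?mulr0 => /eqP.
    by rewrite (negPf xyz0).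
  by rewrite eq_sym mulf_eq0 expf_eq0 (negPf k0) (negPf xyz0).
pose cube3 (P : F * F * F) := let: (x, y, z) := P in (x ^+ 3, y ^+ 3, z ^+ 3).
pose base3 c := match c with 0 => (0, 1, -1)
  | 1 => (x ^+ 3, y ^+ 3, z ^+ 3) | _ => (x ^+ 3, z ^+ 3, y ^+ 3) end.
have cubeE j b d : b ^+ 3 = 1 -> cube3 (ninth j b d) = shift3 j (base3 d).
  move=> h; case: j d => [|[|j]] [|[|d]];
    rewrite /cube3 /base3 /ninth /shift3 /diag3 /base /=;
    by congr (_, _, _); ring: w2 h.
have Ek : shift3 i' (base3 c') = scale3 (k ^+ 3) (shift3 i (base3 c)).
  rewrite -(cubeE i a c ha) -(cubeE i' a' c' ha') E.
  case: (ninth i a c) => [[X Y] Z] /=.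
  by congr (_, _, _); ring.
have [ei ec] : i = i' /\ c = c'.
  case: c c' hc hc' k3 cc Ek {Pk E} => [|c] [|c'] //= hc hc' k3 _; last first.
    rewrite k3 //; move: (x ^+ 3) (y ^+ 3) (z ^+ 3) xy yz xz => X Y Z xy yz xz.
    case: i i' c c' hi hi' hc hc' {k3} => [|[|[|//]]] [|[|[|//]]] [|[|//]]
      [|[|//]] _ _ _ _ /=;
    by rewrite ?mul1r => /inj3[e1 e2 e3]; split=> //; exfalso; congruence.
  move: (k ^+ 3) => l.
  case: i i' hi hi' => [|[|[|//]]] [|[|[|//]]] _ _ /=; rewrite ?mulr0;
    move=> /inj3[/eqP e1 /eqP e2 /eqP e3]; split=> //; move: e1 e2 e3;
    by rewrite ?oppr_eq0 ?oner_eq0 ?andbF.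
subst i' c'; split=> //.
have {E} : diag3 a' (base c) = scale3 k (diag3 a (base c)).
  move: E; rewrite /ninth; case: (diag3 a _) (diag3 a' _) => [[X Y] Z] [[X' Y'] Z'].
  by case: i hi hi' {Pk Ek} => [|[|[|//]]] _ _ /inj3[-> -> ->].
have a0 := n0 _ ha; have wa0 : - w ^+ 2 != 0 by rewrite oppr_eq0 expf_neq0.
case: c hc hc' {k3 cc Pk Ek} => [|[|[|//]]] _ _ /inj3[].
- rewrite !mulr1 => _ e2 e3; apply: (mulfI (mulf_neq0 k0 a0)).
  apply: (mulIf wa0); transitivity (a' ^+ 2 * - w ^+ 2).
    by rewrite e3; ring.
  by rewrite -e2; ring.
- move=> /eqP; rewrite -subr_eq0 -{1}[x]mul1r -mulrBl mulf_eq0 (negPf x0) orbF subr_eq0.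
  by move=> /eqP <- e2 _; move: e2; rewrite mul1r => /(mulIf y0) ->.
- move=> /eqP; rewrite -subr_eq0 -{1}[x]mul1r -mulrBl mulf_eq0 (negPf x0) orbF subr_eq0.
  by move=> /eqP <- e2 _; move: e2; rewrite mul1r => /(mulIf (mulf_neq0 w0 z0)) ->.
Qed.

End NinthDivision.

(** * The embedding of Z/3 + Z/9 *)

Section NinthSubgroup.
Variables (F : fieldType) (w x y z : F).
Hypotheses (w2 : w ^+ 2 = - w - 1) (n3 : (3 : F) != 0).
Hypotheses (x0 : x != 0) (y0 : y != 0) (z0 : z != 0).
Hypotheses (e : fermat w x y z = 0) (c0 : cusp w x y z != 0).
Local Notation t := (hesse_parameter x y z).

Let w3 := cube_root1 w2.

Let w0 : w != 0.
Proof. by apply: contra_eq_neq w3 => ->; rewrite expr0n eq_sym oner_eq0. Qed.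

(* 3Q is the flex acting as diag(1, w^2, w), and j Q with j = 3k + 2 is
   (k + 1) (3Q) - Q. *)
Definition flex_part (j : nat) : F := w ^+ (j %/ 3 + (j %% 3 == 2)%N).*2.

Definition ninth_point (g : ('Z_3 * 'Z_9)%type) : F * F * F :=
  ninth w x y z (val g.1) (flex_part (val g.2)) (val g.2 %% 3).

Lemma flex_part_cube j : flex_part j ^+ 3 = 1.
Proof. by rewrite -exprM mulnC exprM w3 expr1n. Qed.

Lemma flex_part_inj j j' : (j < 9)%N -> (j' < 9)%N ->
  flex_part j = flex_part j' -> (j %% 3 = j' %% 3)%N -> j = j'.
Proof.
have pw : 3.-primitive_root w.
  have w1 : w != 1.
    apply: contraNneq n3 => w1; have := w2; rewrite w1 expr1n => h.
    by rewrite (_ : 3 = 1 - (-1 - 1)); [rewrite -h subrr | ring].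
  apply/andP; split=> //; apply/forallP => -[[|[|[|//]]] hi]; rewrite unity_rootE.
  - by rewrite expr1 (negPf w1).
  - case: (w ^+ 2 =P 1) => // h; case/eqP: w1.
    by rewrite -[LHS]mulr1 -h -exprS w3.
  - by rewrite w3 eqxx.
move=> hj hj' /eqP; rewrite /flex_part (eq_prim_root_expr pw).
by case: j hj => [|[|[|[|[|[|[|[|[|//]]]]]]]]] _;
  case: j' hj' => [|[|[|[|[|[|[|[|[|//]]]]]]]]] _.
Qed.

Lemma oppD_Z3 (i i' : 'Z_3) : val (- (i + i')) = ((i + i').*2 %% 3)%N :> nat.
Proof. by case: i i' => [[|[|[|//]]] ?] [[|[|[|//]]] ?]. Qed.

Lemma oppD_Z9 (j j' : 'Z_9) : let j'' := val (- (j + j')) in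
  [/\ (j'' %% 3 = (j %% 3 + j' %% 3).*2 %% 3)%N &
  flex_part j'' = flex_part j ^+ 2 * flex_part j' ^+ 2
    * carry w (j %% 3) (j' %% 3)].
Proof.
by case: j => [[|[|[|[|[|[|[|[|[|//]]]]]]]]] hj];
  case: j' => [[|[|[|[|[|[|[|[|[|//]]]]]]]]] hj'];
  split=> //; rewrite /flex_part /carry /=; ring: w3.
Qed.

Lemma hesse_curve_subgroup :
  has_subgroup_isog (hesse_curve t) ('Z_3 * 'Z_9)%type.
Proof.
have t3 := hesse_parameter_cube w2 n3 x0 y0 z0 e c0.
have lt3 (j : nat) : (j %% 3 < 3)%N by rewrite ltn_mod.
have hn (g : ('Z_3 * 'Z_9)%type) : ninth_point g != (0, 0, 0).
  have : flex_part (val g.2) != 0 by rewrite expf_neq0.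
  rewrite /ninth_point; case: (val g.1) (_ %% 3)%N => [|[|i]] [|[|c]] f0;
    rewrite /ninth /= !xpair_eqE /= ?mulr1 ?(negPf x0) ?(negPf f0) ?andbF //.
have pN (g : ('Z_3 * 'Z_9)%type) : to_weierstrass w t (ninth_point (- g)) =
    neg_point (hesse_curve t) (to_weierstrass w t (ninth_point g)).
  have [k k0 E] :=
    opp_ninth x y z w2 (ltn_ord g.1) (lt3 g.2) (flex_part_cube g.2).
  rewrite -(to_weierstrass_opp _ w2).
  rewrite -(to_weierstrass_scale _ _ (opp_hesse w (ninth_point g)) k0).
  rewrite [in RHS]/ninth_point -E.
  rewrite /ninth_point; congr (to_weierstrass w t (ninth _ _ _ _ _ _ _)).
  - by have := oppD_Z3 g.1 0; rewrite addr0 addn0.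
  - have [_] := oppD_Z9 g.2 0; rewrite addr0 /= => ->.
    rewrite [X in _ * X ^+ 2 * _](_ : _ = 1) // expr1n mulr1.
    by rewrite (_ : carry _ _ _ = 1) ?mulr1 //; case: (g.2 %% 3)%N => [|[|[]]].
  by have [] := oppD_Z9 g.2 0; rewrite addr0 addn0.
apply: (@hesse_subgroup F w t w2 n3 t3 _ ninth_point) => //.
- by move=> g; apply: on_hesse_ninth => //; apply: flex_part_cube.
- move=> g g' E.
  have oh i j c := on_hesse_ninth w2 n3 x0 y0 z0 i c (flex_part_cube j).
  have [k k0] :=
    to_weierstrass_inj w2 n3 t3 (oh _ _ _) (oh _ _ _) (hn g) (hn g') E.
  move=> /(scale3_ninth w2 x0 y0 z0 e c0 k0).
  case=> //; try exact: flex_part_cube; try exact: ltn_ord.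
  case: g g' {E} => [i j] [i' j'] /= e1 e2 e3; congr (_, _); apply: val_inj => //.
  by apply: flex_part_inj e2 e3; apply: ltn_ord.
- rewrite /to_weierstrass /ninth_point /ninth /flex_part /=.
  by case: eqVneq => //; case/eqP; ring: w3.
- move=> g g'; have [e3 e2] := oppD_Z9 g.2 g'.2.
  rewrite /ninth_point oppD_Z3 e3 e2.
  by apply: det3_ninth => //; rewrite ?flex_part_cube ?ltn_ord.
- move=> g; have [e3 e2] := oppD_Z9 g.2 g.2.
  rewrite /ninth_point oppD_Z3 e3 e2 -exprD.
  rewrite (_ : ((_ + _).*2 %% 3)%N = g.1); last first.
    by case: (g.1) => [[|[|[|//]]] ?].
  rewrite (_ : ((_ %% 3 + _).*2 %% 3)%N = g.2 %% 3)%N; last first.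
    by case: (g.2 %% 3)%N (lt3 g.2) => [|[|[|//]]].
  by apply: polar_ninth; rewrite ?flex_part_cube ?lt3 ?ltn_ord.
(* Tripling kills [(i, j)] only when 3 divides j, that is, for translates of the origin, where a
   coordinate is zero. *)
- move=> [i j]; case: j => [[|[|[|[|[|[|[|[|[|//]]]]]]]]] hj] //
    /(congr1 snd) /(congr1 val) //= _;
  exact: coord_prod_ninth.
Qed.

End NinthSubgroup.

(** * From subgroups to points of the cubic *)

Section Translation.
Variables (F : fieldType) (W : weierstrass F) (r s t : F).
Local Notation a1 := (wa1 W).
Local Notation a2 := (wa2 W).
Local Notation a3 := (wa3 W).
Local Notation a4 := (wa4 W).
Local Notation a6 := (wa6 W).

Definition translate_curve : weierstrass F := Weierstrass (a1 + 2 * s)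
  (a2 - s * a1 + 3 * r - s ^+ 2) (a3 + r * a1 + 2 * t)
  (a4 - s * a3 + 2 * r * a2 - (t + r * s) * a1 + 3 * r ^+ 2 - 2 * s * t)
  (a6 + r * a4 + r ^+ 2 * a2 + r ^+ 3 - t * a3 - t ^+ 2 - r * t * a1).
Local Notation W' := translate_curve.

Definition translate_point (P : option (F * F)) : option (F * F) :=
  if P is Some (x, y) then Some (x - r, y - t - s * (x - r)) else None.

Lemma discriminant_translate : discriminant W' = discriminant W.
Proof. by rewrite /discriminant /=; ring. Qed.

Lemma translate_point_inj : injective translate_point.
Proof.
move=> [[x y]|] [[x' y']|] //= [/addIr <- h].
by congr (Some (_, _)); move: h => /addIr/addIr.
Qed.

Lemma on_curve_translate P : on_curve W P -> on_curve W' (translate_point P).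
Proof.
case: P => [[x y]|] // /eqP e; apply/eqP => /=; apply/eqP.
rewrite -subr_eq0; apply/eqP; move/eqP: e; rewrite -subr_eq0 => /eqP <-; ring.
Qed.

Lemma add_point_translate P Q : on_curve W P -> on_curve W Q ->
  translate_point (add_point W P Q) =
  add_point W' (translate_point P) (translate_point Q).
Proof.
case: P Q => [[x y]|] [[x' y']|] // e e'.
rewrite /translate_point /add_point /= (inj_eq (addIr (- r))).
have -> : y - t - s * (x - r) + (y' - t - s * (x' - r)) +
   (a1 + 2 * s) * (x - r) + (a3 + r * a1 + 2 * t) =
   y + y' + a1 * x + a3 + s * (x - x') by ring.
have [xx|n] := eqVneq x x' => /=.
  subst x'; rewrite subrr mulr0 addr0; case: eqVneq => //= n.
  have yy : y' = y.
    have [//|h] := on_curve_same_x e e'.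
    by case/eqP: n; rewrite h; ring.
  subst y'; have d : 2 * y + a1 * x + a3 != 0.
    by apply: contraNneq n => <-; apply/eqP; ring.
  set l := _ / (2 * y + a1 * x + a3).
  have -> : (3 * (x - r) ^+ 2 + 2 * (a2 - s * a1 + 3 * r - s ^+ 2) * (x - r) +
      (a4 - s * a3 + 2 * r * a2 - (t + r * s) * a1 + 3 * r ^+ 2 - 2 * s * t) -
      (a1 + 2 * s) * (y - t - s * (x - r))) /
      (2 * (y - t - s * (x - r)) + (a1 + 2 * s) * (x - r) +
      (a3 + r * a1 + 2 * t)) = l - s.
    have -> : 2 * (y - t - s * (x - r)) + (a1 + 2 * s) * (x - r) +
      (a3 + r * a1 + 2 * t) = 2 * y + a1 * x + a3 by ring.
    by rewrite /l; field.
  by congr (Some (_, _)); ring.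
have d : x' - x != 0 by rewrite subr_eq0 eq_sym.
have -> : x' - r - (x - r) = x' - x by ring.
set l := (y' - y) / _.
have -> : (y' - t - s * (x' - r) - (y - t - s * (x - r))) / (x' - x) = l - s.
  by rewrite /l; field.
by congr (Some (_, _)); ring.
Qed.

Lemma has_subgroup_translate (A : zmodType) (f : A -> option (F * F)) :
    [/\ injective f, forall g, on_curve W (f g)
      & forall g h, f (g + h) = add_point W (f g) (f h)] ->
  [/\ injective (translate_point \o f),
      forall g, on_curve W' ((translate_point \o f) g)
      & forall g h, (translate_point \o f) (g + h) =
          add_point W' ((translate_point \o f) g) ((translate_point \o f) h)].
Proof.
case=> fi fc fD; split=> [|g|g h] /=.
- exact: inj_comp translate_point_inj fi.
- exact: on_curve_translate.
- by rewrite fD add_point_translate.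
Qed.

End Translation.

(** * Consequences of a group embedding into the points *)

Section PointGroup.
Variables (F : fieldType) (W : weierstrass F) (A : zmodType).
Variable f : A -> option (F * F).
Hypothesis f_inj : injective f.
Hypothesis f_on : forall g, on_curve W (f g).
Hypothesis fD : forall g h, f (g + h) = add_point W (f g) (f h).

(** An affine P with P + P = P obtained from the tangent formula would, its abscissa being
    unchanged, equal its own negative, and then P + P would be the point at infinity. *)
Lemma point_group0 : f 0 = None.
Proof.
have := fD 0 0; rewrite addr0; case: (f 0) => [[x y]|] //=.
rewrite eqxx /=; case: eqVneq => // n [e1 e2]; case/eqP: n.
by rewrite -e1 in e2; rewrite -[RHS](subrr y) [X in _ = y - X]e2; ring.
Qed.

Lemma point_group_eq0 g : f g = None -> g = 0.
Proof. by rewrite -point_group0 => /f_inj. Qed.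

Lemma point_groupN g : f (- g) = neg_point W (f g).
Proof.
have := fD g (- g); rewrite subrr point_group0.
case: (f g) (f (- g)) => [[x y]|] [[x' y']|] //=.
case: ifP => // /andP[/eqP <- /eqP h] _; congr (Some (_, _)).
by rewrite -[LHS]subr0 -h; ring.
Qed.

Lemma point_group_abscissa g h x y x' y' : f g = Some (x, y) ->
  f h = Some (x', y') -> h != g -> h != - g -> x' != x.
Proof.
move=> E E' n1 n2; apply/eqP => ex; subst x'.
have := f_on g; have := f_on h; rewrite E E' => c' c.
case: (on_curve_same_x c c') => ey.
  by case/eqP: n1; apply: f_inj; rewrite E E' ey.
by case/eqP: n2; apply: f_inj; rewrite point_groupN E E' ey.
Qed.

Lemma point_group_double g x y x' y' : f g = Some (x, y) ->
    f (- (g + g)) = Some (x', y') ->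
  [/\ 2 * y + wa1 W * x + wa3 W != 0,
   x' + 2 * x + wa2 W = ((3 * x ^+ 2 + 2 * wa2 W * x + wa4 W - wa1 W * y)
     / (2 * y + wa1 W * x + wa3 W)) ^+ 2 + wa1 W *
     ((3 * x ^+ 2 + 2 * wa2 W * x + wa4 W - wa1 W * y)
     / (2 * y + wa1 W * x + wa3 W))
   & tangent_at W x y x' y'].
Proof.
move=> E E'; have := congr1 (neg_point W) (point_groupN (g + g)).
rewrite neg_pointK E' fD E /= eqxx /=.
have -> : y + y + wa1 W * x + wa3 W = 2 * y + wa1 W * x + wa3 W by ring.
case: eqVneq => // d [ex ey]; split=> //; first by rewrite ex; ring.
rewrite /tangent_at; apply/eqP.
set N := _ - wa1 W * y in ex ey *.
set M := 2 * y + wa1 W * x + wa3 W in d ex ey *.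
have yE : y' - y = N / M * (x' - x).
  rewrite -ex in ey; apply/eqP; rewrite -subr_eq0; apply/eqP.
  transitivity (- (N / M + wa1 W) * x' - (y - N / M * x) - wa3 W
     - (- y' - wa1 W * x' - wa3 W) - 2 * (y - y) ); last first.
    by rewrite ey; ring.
  by ring.
by rewrite yE mulrA [M * _]mulrC divfK.
Qed.

End PointGroup.

(** As -(T + T) = T, the point T is a flex. Moving it to the origin and its tangent to y = 0 kills
    a2, a4 and a6. *)
Lemma order3_normal_form (F : fieldType) (W : weierstrass F) (A : zmodType)
    (T : A) : T != 0 -> T + T + T = 0 -> has_subgroup_isog W A ->
  exists a b (f : A -> option (F * F)), let W' := Weierstrass a 0 b 0 0 in
    [/\ discriminant W' = discriminant W, f T = Some (0, 0), injective f,
        forall g, on_curve W' (f g)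
      & forall g h, f (g + h) = add_point W' (f g) (f h)].
Proof.
move=> T0 T3 [f [fi fc fD]].
case E : (f T) => [[x y]|]; last first.
  by case/eqP: T0; apply: (point_group_eq0 fi fD).
have TT : - (T + T) = T by apply/eqP; rewrite eq_sym -addr_eq0 addrA T3.
have E' : f (- (T + T)) = Some (x, y) by rewrite TT.
have [d xE _] := point_group_double fD E E'.
set l := _ / _ in xE.
have lE : l * (2 * y + wa1 W * x + wa3 W) =
    3 * x ^+ 2 + 2 * wa2 W * x + wa4 W - wa1 W * y by rewrite divfK.
have := fc T; rewrite E => /eqP e.
have W'E : translate_curve W x l y =
    Weierstrass (wa1 W + 2 * l) 0 (wa3 W + x * wa1 W + 2 * y) 0 0.
  congr (Weierstrass _ _ _ _ _).
  - transitivity (x + 2 * x + wa2 W - (l ^+ 2 + wa1 W * l)); first by ring.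
    by rewrite xE subrr.
  - transitivity (3 * x ^+ 2 + 2 * wa2 W * x + wa4 W - wa1 W * y -
      l * (2 * y + wa1 W * x + wa3 W)); first by ring.
    by rewrite lE subrr.
  - transitivity (x ^+ 3 + wa2 W * x ^+ 2 + wa4 W * x + wa6 W -
      (y ^+ 2 + wa1 W * x * y + wa3 W * y)); first by ring.
    by rewrite e subrr.
have [gi gc gD] := @has_subgroup_translate _ W x l y _ f (And3 fi fc fD).
rewrite W'E in gc gD.
exists (wa1 W + 2 * l), (wa3 W + x * wa1 W + 2 * y), (translate_point x l y \o f).
split=> //; first by rewrite -W'E discriminant_translate.
by rewrite /= E /=; congr (Some (_, _)); ring.
Qed.

(** * The noncuspidal point attached to a subgroup *)

Section Forward.
Variables (F : fieldType) (a b : F).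
Local Notation W := (Weierstrass a 0 b 0 0).
Hypotheses (n2 : (2 : F) != 0) (n3 : (3 : F) != 0).
Hypothesis ell : elliptic W.
Variable f : ('Z_3 * 'Z_9)%type -> option (F * F).
Local Notation T := ((0, inZp 3) : ('Z_3 * 'Z_9)%type).
Local Notation Q := ((0, inZp 1) : ('Z_3 * 'Z_9)%type).
Local Notation R := ((inZp 1, 0) : ('Z_3 * 'Z_9)%type).
Hypothesis fT : f T = Some (0, 0).
Hypothesis f_inj : injective f.
Hypothesis f_on : forall g, on_curve W (f g).
Hypothesis fD : forall g h, f (g + h) = add_point W (f g) (f h).

Let disc : b != 0 /\ a ^+ 3 - 27 * b != 0.
Proof.
move: ell; rewrite /elliptic.
have -> : discriminant W = b ^+ 3 * (a ^+ 3 - 27 * b).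
  by rewrite /discriminant /=; ring.
by rewrite mulf_eq0 negb_or expf_eq0 => /andP[].
Qed.
Let b0 := disc.1.

Lemma abscissa_neq0 g x y : f g = Some (x, y) -> g != T -> g != - T -> x != 0.
Proof. by move=> E; apply: (point_group_abscissa f_inj f_on fD fT E). Qed.

Lemma affine_point g : g != 0 -> exists x y, f g = Some (x, y).
Proof.
move=> g0; case E : (f g) => [[x y]|]; first by exists x, y.
by case/eqP: g0; apply: (point_group_eq0 f_inj fD).
Qed.

(** The abscissa x of the 3-torsion point R is a root of the 3-division polynomial divided by x.
    This gives (a x + 3 b)^3 = (a^3 - 27 b) x^3, and the slope denominator M satisfies 3 M^2 = - (a
    x + 3 b)^2, whence a square root of -3. *)
Lemma exists_cube_root_disc : exists w s : F, [/\ w ^+ 2 = - w - 1, s != 0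
  & s ^+ 3 = a ^+ 3 - 27 * b].
Proof.
have [x [y E]] : exists x y, f R = Some (x, y) by apply: affine_point.
have RR : - (R + R) = R by apply/eqP.
have E' : f (- (R + R)) = Some (x, y) by rewrite RR.
have x0 : x != 0 by apply: (abscissa_neq0 E); apply/eqP.
have := f_on R; rewrite E => /eqP /= e.
have [/= d xE _] := point_group_double fD E E'.
set N := 3 * x ^+ 2 + _ + _ - _ in xE.
set M := 2 * y + a * x + b in d xE.
have h : N ^+ 2 + a * N * M - 3 * x * M ^+ 2 = 0.
  transitivity (M ^+ 2 * ((N / M) ^+ 2 + a * (N / M) - (x + 2 * x + 0))).
    by field.
  by rewrite -xE; ring.
have x3 : x ^+ 3 = y ^+ 2 + a * x * y + b * y by rewrite e; ring.
have psi : 3 * x ^+ 3 + a ^+ 2 * x ^+ 2 + 3 * a * b * x + 3 * b ^+ 2 = 0.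
  apply: (mulfI x0); rewrite mulr0 -[RHS]oppr0 -h /N /M.
  by ring: x3.
have s3 : (a * x + 3 * b) ^+ 3 = (a ^+ 3 - 27 * b) * x ^+ 3.
  apply/eqP; rewrite -subr_eq0; apply/eqP.
  by rewrite -[RHS](mulr0 (9 * b)) -psi; ring.
have s0 : a * x + 3 * b != 0.
  have : (a * x + 3 * b) ^+ 3 != 0 by rewrite s3 mulf_neq0 ?expf_neq0 ?disc.2.
  by rewrite expf_eq0.
exists ((3 * M / (a * x + 3 * b) - 1) / 2), ((a * x + 3 * b) / x); split.
- have M2 : 3 * M ^+ 2 = - (a * x + 3 * b) ^+ 2.
    apply/eqP; rewrite -subr_eq0; apply/eqP.
    by rewrite -[RHS](mulr0 4) -psi /M; ring: x3.
  apply/eqP; rewrite -subr_eq0; apply/eqP.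
  transitivity ((9 * M ^+ 2 + 3 * (a * x + 3 * b) ^+ 2) / (4 * (a * x + 3 * b) ^+ 2)).
    by field; rewrite s0 n2 (natrM _ 2 2) mulf_neq0.
  have -> : 9 * M ^+ 2 = 3 * - (a * x + 3 * b) ^+ 2 by rewrite -M2; ring.
  by rewrite mulrN addNr mul0r.
- by rewrite mulf_neq0 ?invr_eq0.
- by rewrite expr_div_n s3 mulfK ?expf_neq0.
Qed.

Lemma exists_fermat : exists w x y z : F, [/\ w ^+ 2 = - w - 1, x != 0,
  fermat w x y z = 0 & cusp w x y z != 0].
Proof.
have [w [s [w2 s0 s3]]] := exists_cube_root_disc.
have [x [y E]] : exists x y, f Q = Some (x, y) by apply: affine_point.
have E6 : f (- T) = Some (0, - b).
  rewrite (point_groupN fD) fT /=; congr (Some (_, _)); ring.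
have x0 : x != 0 by apply: (abscissa_neq0 E); apply/eqP.
have := f_on Q; rewrite E => /eqP /= e.
(* Since T = 3Q, the residual point -2Q of the tangent at Q is also Q - T. *)
have e7 : f (- (Q + Q)) = add_point W (Some (x, y)) (Some (0, - b)).
  by rewrite -E -E6 -fD; congr f; apply/eqP.
rewrite /= (negPf x0) /= in e7.
set m := (- b - y) / (0 - x) in e7.
have [/= d _ /eqP /= tg] := point_group_double fD E e7.
have x3 : x ^+ 3 = y ^+ 2 + a * x * y + b * y by rewrite e; ring.
have y0 : y + a * x + b != 0.
  apply: contraNneq x0 => h; have : x ^+ 3 = 0.
    by rewrite x3 -[RHS](mulr0 y) -h; ring.
  by move/eqP; rewrite expf_eq0.
(* Hesse coordinates of Q for the parameter a / s, with the scaling of [of_weierstrass] adapted to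
   the curve y^2 + a x y + b y = x^3. *)
pose X := s * x / 3; pose e2 := y + a * x + b.
pose Y := (e2 - w * y - w ^+ 2 * b) / 3.
pose Z := (e2 - w ^+ 2 * y - w * b) / 3.
have n27 : (27 : F) != 0 by rewrite (natrX _ 3 3) expf_neq0.
have X3 : X ^+ 3 = (a ^+ 3 - 27 * b) * x ^+ 3 / 27.
  by rewrite /X -s3 !exprMn exprVn -natrX.
have FE : fermat w X Y Z = 0.
  apply: (mulfI (mulf_neq0 n3 y0)); rewrite mulr0.
  (* The tangency of Q - T, multiplied by x^3, is the twisted Fermat equation up to the nonzero
     factor 3 (y + a x + b). *)
  transitivity (((2 * y + a * x + b) * (- (m + a) * (m ^+ 2 + a * m - 0 - x - 0)
     - (y - m * x) - b - y) - (3 * x ^+ 2 + 2 * 0 * x + 0 - a * y) *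
     (m ^+ 2 + a * m - 0 - x - 0 - x)) * x ^+ 3); last first.
    by rewrite tg subrr mul0r.
  rewrite /fermat X3 /Y /Z /e2 /m.
  by field: w2 x3; rewrite oppr_eq0 x0 n3 n27.
have X0 : X != 0 by rewrite !mulf_neq0 ?invr_eq0.
(* At a cusp X^3 = Y^3 = Z^3; the cube of the Hesse equation then gives 27 X^3 = (a x)^3, which
   forces b = 0. *)
exists w, X, Y, Z; split=> //; apply/eqP => cE; case/eqP: b0.
have YX : Y ^+ 3 = X ^+ 3.
  apply: (mulfI n3); apply/eqP; rewrite -subr_eq0; apply/eqP.
  transitivity ((w ^+ 2 - 1) * fermat w X Y Z + (w - 1) * cusp w X Y Z).
      by rewrite /fermat /cusp; ring: w2.
  by rewrite FE cE !mulr0 addr0.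
have ZX : Z ^+ 3 = X ^+ 3.
  apply: (mulfI n3); apply/eqP; rewrite -subr_eq0; apply/eqP.
  transitivity ((w - 1) * fermat w X Y Z + (w ^+ 2 - 1) * cusp w X Y Z).
      by rewrite /fermat /cusp; ring: w2.
  by rewrite FE cE !mulr0 addr0.
have H : X ^+ 3 + Y ^+ 3 + Z ^+ 3 = a * x * Y * Z.
  by rewrite X3 /Y /Z /e2; field: w2 x3; rewrite n3 n27.
have : 27 * X ^+ 9 = (a * x) ^+ 3 * X ^+ 6.
  transitivity ((X ^+ 3 + Y ^+ 3 + Z ^+ 3) ^+ 3); first by rewrite YX ZX; ring.
  rewrite H; transitivity ((a * x) ^+ 3 * Y ^+ 3 * Z ^+ 3); first by ring.
  by rewrite YX ZX; ring.
move/eqP; rewrite -subr_eq0 => /eqP h.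
have nz : - 27 * x ^+ 3 * X ^+ 6 != 0.
  by rewrite mulf_neq0 ?expf_neq0 // mulf_neq0 ?expf_neq0 ?oppr_eq0.
apply: (mulfI nz); rewrite mulr0 -[RHS]h.
transitivity ((27 * X ^+ 3 - (a * x) ^+ 3) * X ^+ 6); last by ring.
by rewrite X3; field.
Qed.

End Forward.

(** * The j-invariant and the conclusion *)

Definition c4 (F : fieldType) (W : weierstrass F) : F :=
  (wa1 W ^+ 2 + 4 * wa2 W) ^+ 2 - 24 * (2 * wa4 W + wa1 W * wa3 W).

Lemma isomorphic_refl (F : fieldType) (W : weierstrass F) : isomorphic W W.
Proof.
exists 1, 0, 0, 0; split; rewrite ?oner_eq0 ?expr1n ?mul1r //; try by ring.
by split; ring.
Qed.

(** An admissible change of variables scales c4 by u^4 and the discriminant by u^12; the equality of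
    j-invariants is cross-multiplied. *)
Lemma isomorphic_j (F : fieldType) (W W' : weierstrass F) : isomorphic W W' ->
  c4 W ^+ 3 * discriminant W' = c4 W' ^+ 3 * discriminant W.
Proof.
case=> u [r [s [t [u0 e1 e2 e3 [e4 e6]]]]].
have hc : u ^+ 4 * c4 W' = c4 W.
  transitivity (((u * wa1 W') ^+ 2 + 4 * (u ^+ 2 * wa2 W')) ^+ 2
    - 24 * (2 * (u ^+ 4 * wa4 W') + (u * wa1 W') * (u ^+ 3 * wa3 W'))).
    by rewrite /c4; ring.
  by rewrite e1 e2 e3 e4 /c4; ring.
have hd : u ^+ 12 * discriminant W' = discriminant W.
  transitivity (discriminant (Weierstrass (u * wa1 W') (u ^+ 2 * wa2 W')
    (u ^+ 3 * wa3 W') (u ^+ 4 * wa4 W') (u ^+ 6 * wa6 W'))).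
    by rewrite /discriminant /=; ring.
  by rewrite e1 e2 e3 e4 e6 /discriminant /=; ring.
by rewrite -hc -hd; ring.
Qed.

Lemma c4_map (F L : fieldType) (f : {rmorphism F -> L}) (W : weierstrass F) :
  c4 (map_weierstrass f W) = f (c4 W).
Proof. by rewrite /c4 /=; ring. Qed.

Lemma discriminant_map (F L : fieldType) (f : {rmorphism F -> L})
  (W : weierstrass F) : discriminant (map_weierstrass f W) = f (discriminant W).
Proof. by rewrite /discriminant /=; ring. Qed.

(** Equal classes make the curves isomorphic over [Kbar], and the resulting equality of j-invariants
    descends because [iota] is injective. *)
Lemma geom_class_j (K Kbar : fieldType) (iota : {rmorphism K -> Kbar})
    (W W' : weierstrass K) :
  elliptic W' -> geom_class iota W = geom_class iota W' ->
  c4 W ^+ 3 * discriminant W' = c4 W' ^+ 3 * discriminant W.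
Proof.
move=> ell e; have : geom_class iota W W'.
  by rewrite e; split=> //; apply: isomorphic_refl.
case=> _ /isomorphic_j; rewrite !c4_map !discriminant_map -!rmorphXn -!rmorphM.
exact: fmorph_inj.
Qed.

Local Open Scope classical_set_scope.

Theorem theorem18 (K : fieldExtType rat) (hK : \dim {:K} = 4%N)
    (Kbar : closedFieldType) (iota : {rmorphism K -> Kbar})
    (hKbar : forall z : Kbar, algebraicOver iota z) :
  ~ (classes_with_subgroup iota ('Z_3 * 'Z_9)%type !=set0
     /\ finite_set (classes_with_subgroup iota ('Z_3 * 'Z_9)%type)).
Proof.
case=> -[_ [W [ell sub] _]] fin.
have n2 := natr_neq0_rat K 1; have n3 := natr_neq0_rat K 2.
have [||a [b [f [dE fT fi fc fD]]]] :=
  @order3_normal_form K W ('Z_3 * 'Z_9)%type (0, inZp 3) _ _ sub.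
- by apply/eqP.
- by apply/eqP.
have ell' : elliptic (Weierstrass a 0 b 0 0) by rewrite /elliptic dE.
have [w [x [y [z [w2 x0 e p0]]]]] := exists_fermat n2 n3 ell' fT fi fc fD.
have dim5 : (\dim {:K} <= 5)%N by rewrite hK.
have [P [hP jP]] := infinite_fermat dim5 w2 x0 e p0.
pose E n := hesse_curve (hesse_parameter3 (P n)).
have dE' n : discriminant (E n) = hesse_disc (hesse_parameter3 (P n)).
  by rewrite /discriminant /E /hesse_disc /=; ring.
have cE n : c4 (E n) = hesse_c4 (hesse_parameter3 (P n)).
  by rewrite /c4 /E /hesse_c4 /=; ring.
have hE n : elliptic (E n) /\ has_subgroup_isog (E n) ('Z_3 * 'Z_9)%type.
  rewrite /elliptic dE' /E; have := hP n.
  case: (P n) => [[x1 y1] z1] [x10 y10 z10 e' c'] /=; split; last first.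
    exact: (hesse_curve_subgroup w2).
  have t3 := hesse_parameter_cube w2 n3 x10 y10 z10 e' c'.
  rewrite /hesse_disc mulf_neq0 ?expf_neq0 ?subr_eq0 //.
  by rewrite (natrX _ 3 3) expf_neq0.
pose g n := geom_class iota (E n).
have g_inj : injective g.
  have lt n n' : (n < n')%N -> g n <> g n'.
    move=> l /(geom_class_j (hE n').1); rewrite !cE !dE'.
    by apply/eqP; apply: jP.
  move=> n n' h; case: (ltngtP n n') => // l; first by case: (lt _ _ l).
  by case: (lt _ _ l).
(* The injective sequence [g] takes all its values in the finite set of classes. *)
apply: infinite_nat; have := finite_preimage (in2W g_inj) fin.
by apply: sub_finite_set => n _; exists (E n).
Qed.
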